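(* Suppose that $\mathcal F=\{\psi_x\}_{x\in X}$ is a continuous frame for $\mathcal H$ with canonical dual $S^{-1}\mathcal F=\{S^{-1}\psi_x\}_{x\in X}$. If both $\mathcal F$ and $S^{-1}\mathcal F$ are intrinsically $\mathcal A_m$-localized, then $\mathsf{Co}\,Y=\widetilde{\mathsf{Co}}\,Y$ with equivalent norms. In particular, $\mathcal H^1_v=\mathcal K^1_v$.
   Context: **Frame.** $\mathcal H$ is a separable Hilbert space (inner product linear in the first slot); $X$ is a locally compact, $\sigma$-compact Hausdorff space with positive Radon measure $\mu$, $\operatorname{supp}\mu=X$. A family $\mathcal F=\{\psi_x\}_{x\in X}\subset\mathcal H$ is a continuous frame if there are $0<C_1,C_2<\infty$ with $C_1\|f\|^2\le\int_X|\langle f,\psi_x\rangle|^2d\mu(x)\le C_2\|f\|^2$ for all $f\in\mathcal H$. Standing: $x\mapsto\psi_x$ is weakly continuous and $\sup_x\|\psi_x\|<\infty$. The frame operator is $Sf=\int_X\langle f,\psi_x\rangle\psi_x\,d\mu(x)$ (weakly), bounded, positive, boundedly invertible. Put $Vf(x)=\langle f,\psi_x\rangle$, $Wf(x)=\langle f,S^{-1}\psi_x\rangle$, $R(x,y)=\langle\psi_y,S^{-1}\psi_x\rangle$. **Kernels.** A kernel $K$ on $X\times X$ acts by $K(F)(x)=\int_XF(y)K(x,y)d\mu(y)$. $\mathcal A_1$ is the space of measurable kernels with $\|K|\mathcal A_1\|=\max\{\operatorname{ess\,sup}_x\int|K(x,y)|d\mu(y),\operatorname{ess\,sup}_y\int|K(x,y)|d\mu(x)\}<\infty$.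 A weight $m:X\times X\to\mathbb R$ is admissible if it is continuous, $1\le m(x,y)\le m(x,z)m(z,y)$, $m(x,y)=m(y,x)$ for all $x,y,z$, and $m(x,x)\le C<\infty$ for all $x$. $\mathcal A_m=\{K: Km\in\mathcal A_1\}$, $\|K|\mathcal A_m\|=\|Km|\mathcal A_1\|$. **Space $Y$.** (Y1) $Y$ is a non-trivial Banach space of functions on $X$, continuously embedded in $L^1_{loc}(X,\mu)$, and solid: $F\in L^1_{loc}$, $G\in Y$, $|F|\le|G|$ a.e. imply $F\in Y$, $\|F|Y\|\le\|G|Y\|$. (Y2) for the admissible weight $m$: $\mathcal A_m(Y)\subset Y$ and $\|K(F)|Y\|\le\|K|\mathcal A_m\|\,\|F|Y\|$ for $K\in\mathcal A_m$, $F\in Y$. Standing: $Y$ and the admissible weight $m$ satisfy (Y1), (Y2), and $R\in\mathcal A_m$. **Coorbit spaces.** Fix $z\in X$, $v(x)=m(x,z)$; $L^1_v=\{F:Fv\in L^1\}$. $\mathcal H^1_v=\{f\in\mathcal H: Vf\in L^1_v\}$ with norm $\|Vf|L^1_v\|$, $\mathcal K^1_v=\{f\in\mathcal H:Wf\in L^1_v\}$ with norm $\|Wf|L^1_v\|$. $B^\urcorner$ is the anti-dual (continuous conjugate-linear functionals), $\langle f,g\rangle:=f(g)$. One has $\psi_x\in\mathcal K^1_v$, $S^{-1}\psi_x\in\mathcal H^1_v$, and $V$, $W$ extend to $(\mathcal K^1_v)^\urcorner$, $(\mathcal H^1_v)^\urcorner$ by $Vf(x)=f(\psi_x)$, $Wf(x)=f(S^{-1}\psi_x)$.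 $\mathsf{Co}\,Y=\{f\in(\mathcal K^1_v)^\urcorner:Vf\in Y\}$, $\|f|\mathsf{Co}\,Y\|=\|Vf|Y\|$; $\widetilde{\mathsf{Co}}\,Y=\{f\in(\mathcal H^1_v)^\urcorner:Wf\in Y\}$, $\|f|\widetilde{\mathsf{Co}}\,Y\|=\|Wf|Y\|$. It is assumed that these are Banach spaces (if they are not complete, they are replaced by their completions). **Localization.** For frames $\mathcal G=\{g_x\}_{x\in X}$, $\mathcal F=\{f_x\}_{x\in X}$ the crossed Gramian kernel is $G(\mathcal G,\mathcal F)(x,y)=\langle f_y,g_x\rangle$. $\mathcal F$ is intrinsically $\mathcal A_m$-localized (also: $\mathcal A_m$-self-localized) if $G(\mathcal F,\mathcal F)\in\mathcal A_m$. *)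

(* Defs.v *)
From HB Require Import structures.
From mathcomp Require Import all_boot all_order all_algebra.
From mathcomp Require Import complex.
From mathcomp Require Import all_classical all_reals all_analysis.
From mathcomp Require Import ess_sup_inf.

Set Implicit Arguments.
Unset Strict Implicit.
Unset Printing Implicit Defensive.

Import Order.TTheory GRing.Theory Num.Theory.
Import numFieldNormedType.Exports.

Local Open Scope classical_set_scope.
Local Open Scope complex_scope.
Local Open Scope ring_scope.

Local Notation normc := Normc.normc.

Notation borel X := (g_sigma_algebraType (@open X)).

(* {dot H for Num.conj} is linear in the first slot, conjugate-linear in the
   second; completeness is part of the type of H. *)
Definition hilbert (R : realType) (H : completeNormedModType R[i])
    (dot : {dot H for Num.conj}) : Prop :=
  forall f : H, dot f f = `|f| ^+ 2.

Definition separable (T : topologicalType) : Prop :=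
  exists s : nat -> T, dense (range s).

(* The norm of H takes its values in R[i]; this is the same number in R. *)
Definition hnorm (R : realType) (H : normedModType R[i]) (f : H) : R := complex.Re `|f|.

Definition sigma_compact (X : topologicalType) : Prop :=
  exists Q : nat -> set X, (forall n, compact (Q n)) /\ \bigcup_n Q n = [set: X].

Section measures.
Context (R : realType) (X : ptopologicalType).
Variable mu : {measure set (borel X) -> \bar R}.
Local Open Scope ereal_scope.

Record radon_measure : Prop := {
  radon_compact : forall Q : set X, compact Q -> mu Q < +oo ;
  radon_outer : forall A : set (borel X), measurable A ->
    mu A = ereal_inf [set mu U | U in [set U : set X | open U /\ A `<=` U]] ;
  radon_inner : forall U : set X, open U ->
    mu U = ereal_sup [set mu Q | Q in [set Q : set X | compact Q /\ Q `<=` U]] }.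

Definition msupport : set X :=
  [set x | forall U : set X, open U -> U x -> 0 < mu U].

End measures.

Section complex_integral.
Context d (T : measurableType d) (R : realType).
Variable mu : {measure set T -> \bar R}.

Definition cmeasurable (F : T -> R[i]) : Prop :=
  measurable_fun setT (fun x => complex.Re (F x)) /\
  measurable_fun setT (fun x => complex.Im (F x)).

Definition cintegrable (F : T -> R[i]) : Prop :=
  mu.-integrable setT (fun x => (complex.Re (F x))%:E) /\
  mu.-integrable setT (fun x => (complex.Im (F x))%:E).

Definition cintegral (F : T -> R[i]) : R[i] :=
  (\int[mu]_x complex.Re (F x)) +i* (\int[mu]_x complex.Im (F x)).

End complex_integral.

Section function_spaces.
Context (R : realType) (X : ptopologicalType).
Variable mu : {measure set (borel X) -> \bar R}.
Local Notation C := R[i].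

Definition L1loc : set (X -> C) :=
  [set F | cmeasurable (F : borel X -> C) /\
    forall Q : set X, compact Q -> (\int[mu]_(x in Q) (normc (F x))%:E < +oo)%E].

Definition L1v_enorm (v : X -> R) (F : X -> C) : \bar R :=
  (\int[mu]_x (normc (F x) * v x)%:E)%E.

Definition L1v (v : X -> R) : set (X -> C) :=
  [set F | cmeasurable (F : borel X -> C) /\ (L1v_enorm v F < +oo)%E].

Record admissible (m : X -> X -> R) : Prop := {
  adm_continuous : continuous (fun p : X * X => m p.1 p.2) ;
  adm_ge1 : forall x y, 1 <= m x y ;
  adm_submult : forall x y z, m x y <= m x z * m z y ;
  adm_sym : forall x y, m x y = m y x ;
  adm_diag : exists c : R, forall x, m x x <= c }.

Definition A1_norm (K : X -> X -> C) : \bar R :=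
  maxe (ess_sup mu (fun x => \int[mu]_y (normc (K x y))%:E)%E)
       (ess_sup mu (fun y => \int[mu]_x (normc (K x y))%:E)%E).

(* Joint measurability is with respect to the product of the Borel
   sigma-algebras, so that Fubini-Tonelli applies. *)
Definition A1 : set (X -> X -> C) :=
  [set K | cmeasurable (fun p : borel X * borel X => K p.1 p.2) /\
           (A1_norm K < +oo)%E].

Definition weighted (m : X -> X -> R) (K : X -> X -> C) : X -> X -> C :=
  fun x y => K x y * (m x y)%:C.

Definition Am_norm (m : X -> X -> R) (K : X -> X -> C) : \bar R :=
  A1_norm (weighted m K).

Definition Am (m : X -> X -> R) : set (X -> X -> C) :=
  [set K | A1 (weighted m K)].

Definition kernel_op (K : X -> X -> C) (F : X -> C) : X -> C :=
  fun x => cintegral mu (fun y : borel X => F y * K x y).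

(* A space of functions modulo equality almost everywhere is given by the set Y
   of all Borel representatives of its elements and by the norm nY seen as a
   seminorm on Y whose kernel consists of the functions that vanish almost
   everywhere.  Solidity makes Y and nY invariant under modification on null
   sets.  The topology of L1loc is that of the seminorms F |-> \int_Q |F|, Q
   compact, hence the form of fs_embedding. *)
Record solid_banach_space (Y : set (X -> C)) (nY : (X -> C) -> R) : Prop := {
  fs_linear : forall (a : C) F G, Y F -> Y G -> Y (fun x => a * F x + G x) ;
  fs_normZ : forall (a : C) F, Y F -> nY (fun x => a * F x) = normc a * nY F ;
  fs_normD : forall F G, Y F -> Y G -> nY (fun x => F x + G x) <= nY F + nY G ;
  fs_norm0 : forall F, Y F -> (nY F = 0 <-> \forall x \ae mu, F x = 0) ;
  fs_complete : forall u : nat -> X -> C, (forall n, Y (u n)) ->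
    (forall e : R, 0 < e -> exists N, forall p q, (N <= p)%N -> (N <= q)%N ->
       nY (fun x => u p x - u q x) < e) ->
    exists F, Y F /\
      forall e : R, 0 < e -> exists N, forall n, (N <= n)%N ->
        nY (fun x => u n x - F x) < e ;
  fs_nontrivial : exists F, Y F /\ ~ (\forall x \ae mu, F x = 0) ;
  fs_L1loc : Y `<=` L1loc ;
  fs_embedding : forall Q : set X, compact Q -> exists c : R, forall F, Y F ->
    (\int[mu]_(x in Q) (normc (F x))%:E <= (c * nY F)%:E)%E ;
  fs_solid : forall F G, L1loc F -> Y G ->
    (\forall x \ae mu, normc (F x) <= normc (G x)) -> Y F /\ nY F <= nY G }.

(* Integrals are total, so the almost everywhere convergence of the integral
   that defines K(F) has to be said. *)
Definition Am_acts (m : X -> X -> R) (Y : set (X -> C)) (nY : (X -> C) -> R) :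
    Prop :=
  forall K F, Am m K -> Y F ->
    [/\ \forall x \ae mu, cintegrable mu (fun y : borel X => F y * K x y),
        Y (kernel_op K F) &
        ((nY (kernel_op K F))%:E <= Am_norm m K * (nY F)%:E)%E ].

End function_spaces.

Section frames.
Context (R : realType) (X : ptopologicalType).
Variable mu : {measure set (borel X) -> \bar R}.
Context (H : completeNormedModType R[i]).
Variable dot : {dot H for Num.conj}.
Local Notation C := R[i].

Definition continuous_frame (psi : X -> H) : Prop :=
  exists C1 C2 : R, [/\ 0 < C1, 0 < C2 & forall f : H,
    ((C1 * hnorm f ^+ 2)%:E <= \int[mu]_x (normc (dot f (psi x)) ^+ 2)%:E /\
     \int[mu]_x (normc (dot f (psi x)) ^+ 2)%:E <= (C2 * hnorm f ^+ 2)%:E)%E].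

Definition weakly_continuous (psi : X -> H) : Prop :=
  forall f : H, continuous (fun x : X => dot f (psi x)).

Definition bounded_family (psi : X -> H) : Prop :=
  exists B : R, forall x, hnorm (psi x) <= B.

(* <Sf, g> = \int <f, psi_x> <psi_x, g> dmu(x); this determines S. *)
Definition frame_operator (psi : X -> H) (S : H -> H) : Prop :=
  forall f g : H,
    dot (S f) g = cintegral mu (fun x : borel X => dot f (psi x) * dot (psi x) g).

Definition gramian (g f : X -> H) : X -> X -> C := fun x y => dot (f y) (g x).

Definition intrinsically_localized (m : X -> X -> R) (f : X -> H) : Prop :=
  Am mu m (gramian f f).

(* For phi = psi this is H^1_v, for phi = S^-1 psi it is K^1_v. *)
Definition H1 (phi : X -> H) (v : X -> R) : set H :=
  [set f | L1v mu v (fun x => dot f (phi x))].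

Definition H1_norm (phi : X -> H) (v : X -> R) (f : H) : R :=
  fine (L1v_enorm mu v (fun x => dot f (phi x))).

(* The antidual of the subspace E of H normed by nE.  A functional on E is
   represented by its extension to H by zero outside E, so that functionals on
   equal subspaces are comparable by Leibniz equality. *)
Definition antidual (E : set H) (nE : H -> R) : set (H -> C) :=
  [set f | [/\ forall (a : C) u w, E u -> E w ->
                 f (a *: u + w) = a^* * f u + f w,
               exists c : R, forall u, E u -> normc (f u) <= c * nE u &
               forall u, ~ E u -> f u = 0]].

Definition coorbit (E : set H) (nE : H -> R) (phi : X -> H)
    (Y : set (X -> C)) : set (H -> C) :=
  [set f | antidual E nE f /\ Y (fun x => f (phi x))].

Definition coorbit_norm (phi : X -> H) (nY : (X -> C) -> R) (f : H -> C) : R :=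
  nY (fun x => f (phi x)).

Definition Co (psi psit : X -> H) (v : X -> R) (Y : set (X -> C)) :=
  coorbit (H1 psit v) (H1_norm psit v) psi Y.

Definition tCo (psi psit : X -> H) (v : X -> R) (Y : set (X -> C)) :=
  coorbit (H1 psi v) (H1_norm psi v) psit Y.

End frames.

Definition equivalent_norms (R : realType) (U : Type) (E : set U)
    (n1 n2 : U -> R) : Prop :=
  exists c1 c2 : R, [/\ 0 < c1, 0 < c2 &
    forall f, E f -> c1 * n1 f <= n2 f /\ n2 f <= c2 * n1 f].

(* (B, i) is a completion of the space E of functions T -> R[i], normed by n. *)
Definition completion (R : realType) (T : Type) (E : set (T -> R[i]))
    (n : (T -> R[i]) -> R) (B : completeNormedModType R[i])
    (i : (T -> R[i]) -> B) : Prop :=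
  [/\ forall (a : R[i]) f g, E f -> E g ->
        i (fun t => a * f t + g t) = a *: i f + i g,
      forall f, E f -> `|i f| = (n f)%:C &
      dense (i @` E)].

(* Coorbit spaces that are not complete are understood as their completions; for
   those, equality with equivalent norms means that the identity of E extends to
   an isomorphism. *)
Definition same_completions (R : realType) (T : Type) (E : set (T -> R[i]))
    (n1 n2 : (T -> R[i]) -> R) : Prop :=
  forall (B1 B2 : completeNormedModType R[i])
         (i1 : (T -> R[i]) -> B1) (i2 : (T -> R[i]) -> B2),
    completion E n1 i1 -> completion E n2 i2 ->
    exists (J : {linear B1 -> B2}) (J' : B2 -> B1),
      [/\ cancel J J' /\ cancel J' J, continuous J, continuous J' &
          forall f, E f -> J (i1 f) = i2 f].

(* Main.v *)
(* Write E for H^1_v or K^1_v: the f in H with \int |<f, eta_x>| v(x) < +oo.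
   Since f = \int <f, S^-1 psi_y> psi_y dmu(y) weakly, Vf is the image of Wf
   under the Gramian of psi, and Wf that of Vf under the Gramian of S^-1 psi;
   Schur's test and m(x, z) <= m(x, y) m(y, z) give H^1_v = K^1_v, hence equal
   antiduals.  For f in the antidual, Wf = K(Vf) with K the Gramian of S^-1 psi,
   so that (Y2) and solidity conclude, provided f commutes with the weak integral
   of the reproducing formula.  No duality theory is needed for this: E is
   separable in its own norm (by Scheffe's lemma, because H is separable), hence
   y |-> psi_y is approximated in \int |<g, S^-1 psi_y>| |psi_y - q_y|_E dmu(y)
   by simple functions q with values in E, for which the exchange is linearity. *)

From HB Require Import structures.
Require Import Defs.
From mathcomp Require Import all_boot all_order all_algebra.
From mathcomp Require Import complex ring lra.
From mathcomp Require Import all_classical all_reals all_analysis.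
From mathcomp Require Import measurable_realfun ess_sup_inf.

Set Implicit Arguments.
Unset Strict Implicit.
Unset Printing Implicit Defensive.

Import Order.TTheory GRing.Theory Num.Theory.
Import numFieldNormedType.Exports.
Local Open Scope classical_set_scope.
Local Open Scope ring_scope.

Local Notation normc := Normc.normc.
Local Notation Re := complex.Re.
Local Notation Im := complex.Im.

(** * Complex-valued integration *)

(** Localization controls the Gramian integrals for almost every point only, so a frame vector may
    lie outside E on a null set; there a functional of the antidual vanishes by the convention of
    extension by zero. Hence the formula for f(b_x) as the value at x of a kernel operator applied
    to f(a_.) holds everywhere once it is cut off by the indicator of the Borel set where b_x lies
    in E. This also makes f(b_.) measurable, which is not known beforehand: membership in [Y] is
    given for f(a_.) alone. The three Gramians have different tasks. The cross Gramian bounds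
    |a_y|_E by C v(y) when E is normed through b, so the reproducing integral is absolutely
    convergent in E; the Gramian of b maps f(a_.) to f(b_.); the Gramian of a sends H^1 of b into
    H^1 of a. Everything is stated for an ordered pair (a, b) of dual families and applied in both
    orders. X need not be second countable, so separate continuity of a Gramian does not settle its
    measurability for the product of the Borel sigma-algebras; the separability of H does. *)

Section complex_numbers.
Context (R : realType).
Implicit Types a b : R[i].

Lemma normc_norm a : `|a| = (normc a)%:C%C.
Proof. by []. Qed.

Lemma normc_ge0 a : 0 <= normc a.
Proof. by case: a => x y /=; rewrite sqrtr_ge0. Qed.

Lemma normc_triangle a b : normc (a + b) <= normc a + normc b.
Proof. exact: le_normcD. Qed.

Lemma normc_conj a : normc (Num.conj a) = normc a.
Proof. by case: a => x y /=; rewrite sqrrN. Qed.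

Lemma Re_le_normc a : `|Re a| <= normc a.
Proof.
by case: a => x y /=; rewrite -sqrtr_sqr ler_wsqrtr// lerDl sqr_ge0.
Qed.

Lemma Im_le_normc a : `|Im a| <= normc a.
Proof.
by case: a => x y /=; rewrite -sqrtr_sqr ler_wsqrtr// lerDr sqr_ge0.
Qed.

Lemma normc_le_ReIm a : normc a <= `|Re a| + `|Im a|.
Proof.
case: a => x y /=; rewrite -[leRHS]ger0_norm ?addr_ge0// -sqrtr_sqr ler_wsqrtr//.
by rewrite sqrrD !real_normK ?num_real// lerD2r lerDl mulrn_wge0 ?mulr_ge0.
Qed.

Lemma normcR (x : R) : normc (x%:C)%C = `|x|.
Proof. by rewrite /= expr0n /= addr0 sqrtr_sqr. Qed.

Lemma ReD a b : Re (a + b) = Re a + Re b. Proof. by case: a; case: b. Qed.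
Lemma ImD a b : Im (a + b) = Im a + Im b. Proof. by case: a; case: b. Qed.
Lemma ReM a b : Re (a * b) = Re a * Re b - Im a * Im b.
Proof. by case: a; case: b. Qed.
Lemma ImM a b : Im (a * b) = Re a * Im b + Im a * Re b.
Proof. by case: a; case: b. Qed.

End complex_numbers.

Section complex_measurable.
Context d (T : measurableType d) (R : realType).
Implicit Types F G : T -> R[i].

Lemma cmeasurable_cst (a : R[i]) : cmeasurable (fun _ : T => a).
Proof. by split; exact: measurable_cst. Qed.

Lemma cmeasurableD F G : cmeasurable F -> cmeasurable G ->
  cmeasurable (fun x => F x + G x).
Proof.
move=> [mF1 mF2] [mG1 mG2]; split.
- by under eq_fun do rewrite ReD; exact: measurable_funD.
- by under eq_fun do rewrite ImD; exact: measurable_funD.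
Qed.

Lemma cmeasurableM F G : cmeasurable F -> cmeasurable G ->
  cmeasurable (fun x => F x * G x).
Proof.
move=> [mF1 mF2] [mG1 mG2]; split.
- under eq_fun do rewrite ReM.
  by apply: measurable_funB; exact: measurable_funM.
- under eq_fun do rewrite ImM.
  by apply: measurable_funD; exact: measurable_funM.
Qed.

Lemma cmeasurableN F : cmeasurable F -> cmeasurable (fun x => - F x).
Proof.
move=> mF; rewrite [X in cmeasurable X](_ : _ = (fun x => -1 * F x)).
  exact: (cmeasurableM (cmeasurable_cst _)).
by apply/funext => x; rewrite mulN1r.
Qed.

Lemma cmeasurableB F G : cmeasurable F -> cmeasurable G ->
  cmeasurable (fun x => F x - G x).
Proof. by move=> mF /cmeasurableN; exact: cmeasurableD. Qed.

Lemma cmeasurable_conj F : cmeasurable F ->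
  cmeasurable (fun x => Num.conj (F x)).
Proof.
move=> [mF1 mF2]; split.
- rewrite (_ : (fun _ => _) = (fun x => Re (F x)))//.
  by apply/funext => x /=; case: (F x).
- rewrite (_ : (fun _ => _) = (fun x => - Im (F x))); last first.
    by apply/funext => x /=; case: (F x).
  exact: measurable_funN.
Qed.

Lemma cmeasurable_indic (A : set T) : measurable A ->
  cmeasurable (fun x => (\1_A x : R)%:C%C).
Proof.
by move=> mA; split => /=; [exact: measurable_indic|exact: measurable_cst].
Qed.

Lemma cmeasurable_sum (I : Type) (s : seq I) (F : I -> T -> R[i]) :
  (forall i, cmeasurable (F i)) -> cmeasurable (fun x => \sum_(i <- s) F i x).
Proof.
move=> mF; elim: s => [|i s IH].
  by under eq_fun do rewrite big_nil; exact: cmeasurable_cst.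
by under eq_fun do rewrite big_cons; exact: cmeasurableD.
Qed.

Lemma measurable_normc F : cmeasurable F ->
  measurable_fun setT (fun x => normc (F x)).
Proof.
move=> [mF1 mF2].
rewrite (_ : (fun _ => _) =
    (fun x => Num.sqrt (Re (F x) ^+ 2 + Im (F x) ^+ 2))); last first.
  by apply/funext => x; case: (F x).
apply: (@measurableT_comp _ _ _ _ _ _ (@Num.sqrt R)).
  by apply: continuous_measurable_fun; exact: sqrt_continuous.
by apply: measurable_funD; exact: measurable_funX.
Qed.

Lemma measurable_normcE F : cmeasurable F ->
  measurable_fun setT (fun x => (normc (F x))%:E).
Proof. by move=> mF; apply/measurable_EFinP; exact: measurable_normc. Qed.

End complex_measurable.

Lemma cmeasurable_comp d1 d2 (T1 : measurableType d1) (T2 : measurableType d2)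
    (R : realType) (f : T1 -> T2) (F : T2 -> R[i]) :
  measurable_fun setT f -> cmeasurable F -> cmeasurable (fun x => F (f x)).
Proof.
move=> mf [mF1 mF2]; split.
- exact: (measurableT_comp mF1 mf).
- exact: (measurableT_comp mF2 mf).
Qed.

Section complex_integral_theory.
Context d (T : measurableType d) (R : realType).
Variable mu : {measure set T -> \bar R}.
Implicit Types F G : T -> R[i].

Lemma cintegrableP F : cmeasurable F ->
  (\int[mu]_x (normc (F x))%:E < +oo)%E -> cintegrable mu F.
Proof.
move=> mF F_lty; have mnF := measurable_normcE mF.
have iF : mu.-integrable setT (fun x => (normc (F x))%:E).
  apply/integrableP; split=> //; apply: le_lt_trans F_lty.
  by under eq_integral do rewrite gee0_abs ?lee_fin ?normc_ge0//.
case: mF => mF1 mF2; split; apply: le_integrable iF => //.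
- exact/measurable_EFinP.
- by move=> x _; rewrite /= lee_fin (ger0_norm (normc_ge0 _)) Re_le_normc.
- exact/measurable_EFinP.
- by move=> x _; rewrite /= lee_fin (ger0_norm (normc_ge0 _)) Im_le_normc.
Qed.

Lemma cintegrable_cmeasurable F : cintegrable mu F -> cmeasurable F.
Proof.
by move=> [/integrableP[/measurable_EFinP ? _] /integrableP[/measurable_EFinP]].
Qed.

Lemma le_integral_normc F : cintegrable mu F ->
  (\int[mu]_x (normc (F x))%:E <=
   \int[mu]_x `|Re (F x)|%:E + \int[mu]_x `|Im (F x)|%:E)%E.
Proof.
move=> iF; have [mF1 mF2] := cintegrable_cmeasurable iF.
have mR : measurable_fun setT (fun x => `|Re (F x)|%:E).
  by apply/measurable_EFinP; exact: measurableT_comp.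
have mI : measurable_fun setT (fun x => `|Im (F x)|%:E).
  by apply/measurable_EFinP; exact: measurableT_comp.
rewrite -ge0_integralD//.
apply: ge0_le_integral => //.
- by move=> x _; rewrite lee_fin normc_ge0.
- exact: measurable_normcE.
- exact: emeasurable_funD.
- by move=> x _; rewrite -EFinD lee_fin normc_le_ReIm.
Qed.

Lemma cintegrable_normc F : cintegrable mu F ->
  (\int[mu]_x (normc (F x))%:E < +oo)%E.
Proof.
move=> iF; apply: le_lt_trans (le_integral_normc iF) _.
by case: iF => /integrableP[_ i1] /integrableP[_ i2]; exact: lte_add_pinfty.
Qed.

(* Not sharp (the optimal constant is 1), to avoid a rotation argument. *)
Lemma normc_cintegral_le F : cintegrable mu F ->
  ((normc (cintegral mu F))%:E <= 2%:E * \int[mu]_x (normc (F x))%:E)%E.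
Proof.
move=> iF; have [mF1 mF2] := cintegrable_cmeasurable iF; case: (iF) => i1 i2.
have nF : measurable_fun setT (fun x => (normc (F x))%:E).
  exact: measurable_normcE.
apply: (@le_trans _ _
    (\int[mu]_x `|Re (F x)|%:E + \int[mu]_x `|Im (F x)|%:E)%E).
  apply: (@le_trans _ _ (`|\int[mu]_x Re (F x)|%:E + `|\int[mu]_x Im (F x)|%:E)%E).
    by rewrite -EFinD lee_fin; exact: (normc_le_ReIm (_ +i* _)%C).
  rewrite !EFin_normr_Rintegral//.
  by apply: leeD; apply: le_abse_integral => //;
    [case/integrableP: i1|case/integrableP: i2].
have mR : measurable_fun setT (fun x => `|Re (F x)|%:E).
  by apply/measurable_EFinP; exact: measurableT_comp.
have mI : measurable_fun setT (fun x => `|Im (F x)|%:E).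
  by apply/measurable_EFinP; exact: measurableT_comp.
rewrite (_ : 2%:E = 1 + 1)%E// ge0_muleDl// !mul1e; apply: leeD.
- by apply: ge0_le_integral => // x _; rewrite lee_fin Re_le_normc.
- by apply: ge0_le_integral => // x _; rewrite lee_fin Im_le_normc.
Qed.

Lemma cintegrableD F G : cintegrable mu F -> cintegrable mu G ->
  cintegrable mu (fun x => F x + G x).
Proof.
move=> [iF1 iF2] [iG1 iG2]; split.
- by under eq_fun do rewrite ReD EFinD; exact: integrableD.
- by under eq_fun do rewrite ImD EFinD; exact: integrableD.
Qed.

Lemma cintegralD F G : cintegrable mu F -> cintegrable mu G ->
  cintegral mu (fun x => F x + G x) = cintegral mu F + cintegral mu G.
Proof.
move=> [iF1 iF2] [iG1 iG2]; rewrite /cintegral.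
have -> : (fun x => Re (F x + G x)) = (fun x => Re (F x) + Re (G x)).
  by apply/funext => x; rewrite ReD.
have -> : (fun x => Im (F x + G x)) = (fun x => Im (F x) + Im (G x)).
  by apply/funext => x; rewrite ImD.
by rewrite !RintegralD.
Qed.

Lemma cintegrableZ (a : R[i]) F : cintegrable mu F ->
  cintegrable mu (fun x => a * F x).
Proof.
move=> [iF1 iF2]; split.
- under eq_fun do rewrite ReM EFinB !EFinM.
  by apply: integrableB => //; exact: integrableZl.
- under eq_fun do rewrite ImM EFinD !EFinM.
  by apply: integrableD => //; exact: integrableZl.
Qed.

Lemma cintegralZ (a : R[i]) F : cintegrable mu F ->
  cintegral mu (fun x => a * F x) = a * cintegral mu F.
Proof.
move=> [iF1 iF2]; rewrite /cintegral.
have -> : (fun x => Re (a * F x)) = (fun x => Re a * Re (F x) - Im a * Im (F x)).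
  by apply/funext => x; rewrite ReM.
have -> : (fun x => Im (a * F x)) = (fun x => Re a * Im (F x) + Im a * Re (F x)).
  by apply/funext => x; rewrite ImM.
have iZ (r : R) (f : T -> R) : mu.-integrable setT (fun x => (f x)%:E) ->
    mu.-integrable setT (fun x => (r * f x)%:E).
  by move=> ?; under eq_fun do rewrite EFinM; exact: integrableZl.
rewrite RintegralB//; [|exact: iZ..]; rewrite RintegralD//; [|exact: iZ..].
by rewrite !RintegralZl//; case: a.
Qed.

Lemma cintegral_conj F : cintegrable mu F -> cintegral mu (fun x => Num.conj (F x)) =
  Num.conj (cintegral mu F).
Proof.
move=> iF; rewrite /cintegral.
have -> : (fun x => Re (Num.conj (F x))) = (fun x => Re (F x)).
  by apply/funext => x; case: (F x).
have -> : (fun x => Im (Num.conj (F x))) = (fun x => - Im (F x)).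
  by apply/funext => x; case: (F x).
rewrite /=; congr (_ +i* _)%C.
rewrite -mulN1r -RintegralZl//; last by case: iF.
by apply: eq_Rintegral => x _; rewrite mulN1r.
Qed.

Lemma cintegrableB F G : cintegrable mu F -> cintegrable mu G ->
  cintegrable mu (fun x => F x - G x).
Proof.
move=> iF iG; rewrite (_ : (fun _ => _) = (fun x => F x + -1 * G x)).
  exact/cintegrableD/cintegrableZ.
by apply/funext => x; rewrite mulN1r.
Qed.

Lemma cintegralB F G : cintegrable mu F -> cintegrable mu G ->
  cintegral mu (fun x => F x - G x) = cintegral mu F - cintegral mu G.
Proof.
move=> iF iG; rewrite (_ : (fun _ => _) = (fun x => F x + -1 * G x)).
  by rewrite cintegralD ?cintegralZ ?mulN1r//; exact: cintegrableZ.
by apply/funext => x; rewrite mulN1r.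
Qed.

Lemma cintegral_sum (I : Type) (s : seq I) (F : I -> T -> R[i]) :
  (forall i, cintegrable mu (F i)) ->
  cintegrable mu (fun x => \sum_(i <- s) F i x) /\
  cintegral mu (fun x => \sum_(i <- s) F i x) =
    \sum_(i <- s) cintegral mu (F i).
Proof.
move=> iF; elim: s => [|i s [IH1 IH2]].
  under eq_fun do rewrite big_nil; rewrite big_nil /cintegral /Rintegral /=.
  by rewrite integral0 /cintegrable /=; split => //; split; exact: integrable0.
under eq_fun do rewrite big_cons; rewrite big_cons -IH2; split.
  exact: cintegrableD.
exact: cintegralD.
Qed.

End complex_integral_theory.

(** * Hilbert spaces and joint measurability *)

Section hilbert_space.
Context (R : realType) (H : completeNormedModType R[i]).
Variable dot : {dot H for Num.conj}.
Hypothesis H_hilbert : hilbert dot.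
Implicit Types f g : H.

Lemma hnormE f : `|f| = ((hnorm f)%:C)%C.
Proof. by rewrite /hnorm RRe_real// ger0_real. Qed.

Lemma hnorm_ge0 f : 0 <= hnorm f.
Proof. by rewrite -lecR -hnormE; exact: normr_ge0. Qed.

Lemma ler_hnormD f g : hnorm (f + g) <= hnorm f + hnorm g.
Proof. by have := ler_normD f g; rewrite !hnormE -rmorphD lecR. Qed.

Lemma hnormZ a f : hnorm (a *: f) = normc a * hnorm f.
Proof. by apply: complexI; rewrite rmorphM /= -!hnormE normrZ. Qed.

Lemma hnormN f : hnorm (- f) = hnorm f.
Proof. by rewrite /hnorm normrN. Qed.

Lemma hnormB f g : hnorm (f - g) = hnorm (g - f).
Proof. by rewrite -hnormN opprB. Qed.

Lemma dot_hnorm f : dot f f = ((hnorm f ^+ 2)%:C)%C.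
Proof. by rewrite H_hilbert hnormE rmorphXn. Qed.

Lemma dotC f g : dot f g = Num.conj (dot g f).
Proof. by rewrite hermC /= expr0 mul1r. Qed.

Lemma dotDl f g u : dot (f + g) u = dot f u + dot g u.
Proof. exact: linearDl. Qed.

Lemma dotZl a f u : dot (a *: f) u = a * dot f u.
Proof. by rewrite linearZl_LR. Qed.

Lemma dotBl f g u : dot (f - g) u = dot f u - dot g u.
Proof. by rewrite dotDl -scaleN1r dotZl mulN1r. Qed.

Lemma dotDr u f g : dot u (f + g) = dot u f + dot u g.
Proof. by rewrite dotC dotDl rmorphD /= -!dotC. Qed.

Lemma dotZr a u f : dot u (a *: f) = Num.conj a * dot u f.
Proof. by rewrite dotC dotZl rmorphM /= -dotC. Qed.

Lemma dotBr u f g : dot u (f - g) = dot u f - dot u g.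
Proof. by rewrite dotDr -scaleN1r dotZr rmorphN1 mulN1r. Qed.

Lemma dot0l u : dot 0 u = 0.
Proof. by rewrite -(scale0r (0 : H)) dotZl mul0r. Qed.

Lemma dot_suml (I : Type) (s : seq I) (F : I -> H) u :
  dot (\sum_(i <- s) F i) u = \sum_(i <- s) dot (F i) u.
Proof.
by elim: s => [|i s IH]; rewrite ?big_nil ?dot0l// !big_cons dotDl IH.
Qed.

Lemma normc_sqr (a : R[i]) : a * Num.conj a = ((normc a ^+ 2)%:C)%C.
Proof. by rewrite -normCK normc_norm rmorphXn. Qed.

Lemma cauchy_schwarz f g : normc (dot f g) <= hnorm f * hnorm g.
Proof.
have [g0|g_neq0] := eqVneq (hnorm g) 0.
  have -> : g = 0 by apply/eqP; rewrite -normr_eq0 hnormE g0.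
  by rewrite dotC normc_conj dot0l Normc.normc0 mulr_ge0 ?hnorm_ge0.
have g_gt0 : 0 < hnorm g by rewrite lt_neqAle eq_sym g_neq0 hnorm_ge0.
(* [n *: f - a *: g] is |g|^2 times the component of [f] orthogonal to [g]; this scaling avoids
   every division. *)
pose n := ((hnorm g ^+ 2)%:C)%C; pose a := dot f g.
have nC : Num.conj n = n by exact: conjc_real.
have E : dot (n *: f - a *: g) (n *: f - a *: g) =
    ((hnorm g ^+ 2 * (hnorm g ^+ 2 * hnorm f ^+ 2 - normc a ^+ 2))%:C)%C.
  transitivity (n * (n * dot f f - a * Num.conj a)); last first.
    by rewrite dot_hnorm normc_sqr -rmorphM -rmorphB -rmorphM.
  rewrite dotBl !dotZl !dotBr !dotZr nC -/a (dotC g f) -/a (dot_hnorm g) -/n.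
  by ring.
have : 0 <= hnorm g ^+ 2 * (hnorm g ^+ 2 * hnorm f ^+ 2 - normc a ^+ 2).
  by rewrite -lecR -E dot_hnorm lecR sqr_ge0.
rewrite pmulr_rge0 ?exprn_gt0// subr_ge0 -exprMn mulrC.
by rewrite ler_sqr ?nnegrE ?mulr_ge0 ?hnorm_ge0 ?normc_ge0.
Qed.

Lemma separable_hnorm : separable H ->
  exists s : nat -> H, forall f (e : R), 0 < e -> exists n, hnorm (f - s n) < e.
Proof.
move=> [s ds]; exists s => f e e0.
have [||x [/= fh [n _ nh]]] := ds (ball f (e%:C)%C).
- by exists f; apply: ballxx; rewrite ltcR.
- exact: ball_open.
exists n; rewrite -ltcR -hnormE nh.
by move: fh; rewrite -ball_normE.
Qed.

Section weakly_measurable.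
Context d (T : measurableType d).
Variable s : nat -> H.
Hypothesis s_dense : forall f (e : R), 0 < e -> exists n, hnorm (f - s n) < e.

Definition weakly_measurable (phi : T -> H) :=
  forall f, cmeasurable (fun x => dot f (phi x)).

Lemma weakly_measurableC (phi : T -> H) f : weakly_measurable phi ->
  cmeasurable (fun x => dot (phi x) f).
Proof.
by move=> /(_ f)/cmeasurable_conj; under eq_fun do rewrite -dotC.
Qed.

Lemma weakly_measurableB (phi : T -> H) f : weakly_measurable phi ->
  weakly_measurable (fun x => phi x - f).
Proof.
move=> mphi g; under eq_fun do rewrite dotBr.
exact: cmeasurableB (mphi g) (cmeasurable_cst _ _).
Qed.

(** Testing against countably many vectors writes the condition |phi x| <= r as a countable
    intersection of weakly measurable conditions. For the converse, [f] is tested against a vector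
    of [s] close to [f] itself. *)
Lemma hnorm_leP f (r : R) : 0 <= r ->
  (hnorm f <= r <-> forall n, normc (dot f (s n)) <= r * hnorm (s n)).
Proof.
move=> r0; split=> [fr n|fr].
  by apply: le_trans (cauchy_schwarz _ _) _; rewrite ler_wpM2r ?hnorm_ge0.
have [->|f_neq0] := eqVneq (hnorm f) 0; first exact: r0.
have f_gt0 : 0 < hnorm f by rewrite lt_neqAle eq_sym f_neq0 hnorm_ge0.
have sqr_f : hnorm f ^+ 2 = normc (dot f f).
  by rewrite dot_hnorm normcR ger0_norm ?sqr_ge0.
rewrite -(ler_pM2r f_gt0) -expr2 sqr_f; apply/ler_addgt0Pr => e e0.
(* Replacing [f] by [s n] in |<f, f>| costs |f - s n| twice: with factor [r] through |s n|, and with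
   factor |f| through Cauchy-Schwarz. Hence the tolerance e / (r + |f|). *)
have rf0 : 0 < r + hnorm f by rewrite ltr_wpDl.
have [n fn] := s_dense f (divr_gt0 e0 rf0).
have -> : dot f f = dot f (s n) + dot f (f - s n) by rewrite -dotDr addrC subrK.
apply: le_trans (normc_triangle _ _) _.
apply: (@le_trans _ _ (r * hnorm (s n) + hnorm f * hnorm (f - s n))).
  by apply: lerD; [exact: fr|exact: cauchy_schwarz].
have sn : hnorm (s n) <= hnorm f + hnorm (f - s n).
  by rewrite -{1}(subKr f (s n)) -[leRHS](_ : hnorm f + hnorm (- (f - s n)) = _)
     ?ler_hnormD// hnormN.
apply: (@le_trans _ _ (r * hnorm f + (r + hnorm f) * hnorm (f - s n))).
  have := ler_wpM2l r0 sn; lra.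
by rewrite lerD2l mulrC -ler_pdivlMr// ltW.
Qed.

Lemma measurable_hnorm (phi : T -> H) : weakly_measurable phi ->
  measurable_fun setT (fun x => hnorm (phi x)).
Proof.
move=> mphi.
have mle r : measurable [set x | hnorm (phi x) <= r].
  have [r0|r0] := ltP r 0.
    rewrite (_ : [set x | _] = set0)//.
    rewrite -subset0 => x /=; rewrite leNgt => /negP; apply.
    exact: lt_le_trans r0 (hnorm_ge0 _).
  rewrite (_ : [set x | _] =
      \bigcap_n [set x | normc (dot (phi x) (s n)) <= r * hnorm (s n)]).
    apply: bigcap_measurableType => n _; rewrite -[X in measurable X]setTI.
    have mn := measurable_normc (weakly_measurableC (s n) mphi).
    exact: (measurable_fun_ler mn (measurable_cst _) measurableT (Y := [set true])).
  apply/seteqP; split => x /=.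
    by move=> /(hnorm_leP _ r0) xr n _; exact: xr.
  by move=> xr; apply/(hnorm_leP _ r0) => n; exact: xr.
apply: (measurability _ (RGenOInfty.measurableE R)) => //.
move=> /= _ [_ [a ->] <-]; rewrite setTI preimage_itvoy.
rewrite (_ : [set x | _] = ~` [set x | hnorm (phi x) <= a]).
  exact: measurableC.
by apply/seteqP; split => x /=; rewrite ltNge => /negP.
Qed.

End weakly_measurable.

Section joint_measurability.
Context d1 d2 (T1 : measurableType d1) (T2 : measurableType d2).
Variable s : nat -> H.
Hypothesis s_dense : forall f (e : R), 0 < e -> exists n, hnorm (f - s n) < e.

(* [Re <phi y, eta u> > c] iff some [s i] and [j] satisfy
   [|phi y - s i| <= 1 / (j + 1)] and
   [Re <s i, eta u> > c + |eta u| / (j + 1)], a countable union of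
   rectangles. *)
Lemma measurable_Re_dot (phi : T2 -> H) (eta : T1 -> H) :
  weakly_measurable phi -> weakly_measurable eta ->
  measurable_fun setT (fun p : T1 * T2 => Re (dot (phi p.2) (eta p.1))).
Proof.
move=> mphi meta.
apply: (measurability _ (RGenOInfty.measurableE R)) => //.
move=> /= _ [_ [c ->] <-]; rewrite setTI preimage_itvoy.
pose A i j : set T1 :=
  [set u | c + hnorm (eta u) / j.+1%:R < Re (dot (s i) (eta u))].
pose B i j : set T2 := [set y | hnorm (phi y - s i) <= j.+1%:R^-1].
rewrite (_ : [set p | _] = \bigcup_i \bigcup_j (A i j `*` B i j)).
  apply: bigcup_measurable => i _; apply: bigcup_measurable => j _.
  apply: measurableX; rewrite /A /B -[X in measurable X]setTI.
    have mr : measurable_fun [set: T1] (fun u => c + hnorm (eta u) / j.+1%:R).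
      apply: measurable_funD => //; apply: measurable_funM => //.
      exact: (measurable_hnorm s_dense).
    exact: (measurable_fun_ltr mr (proj1 (meta (s i))) measurableT (Y := [set true])).
  have ms := measurable_hnorm s_dense (weakly_measurableB (s i) mphi).
  exact: (measurable_fun_ler ms (measurable_cst _) measurableT (Y := [set true])).
have close f g h (r : R) : hnorm (f - g) <= r ->
    `|Re (dot f h) - Re (dot g h)| <= hnorm h * r.
  move=> fg; have -> : Re (dot f h) - Re (dot g h) = Re (dot (f - g) h).
    by rewrite dotBl; case: (dot f h); case: (dot g h).
  apply: le_trans (Re_le_normc _) _; apply: le_trans (cauchy_schwarz _ _) _.
  by rewrite mulrC ler_wpM2l ?hnorm_ge0.
apply/seteqP; split => [[u y]|[u y] [i _ [j _ [/= Au By]]]] /=; last first.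
  have := close _ _ (eta u) _ By; rewrite ler_norml => /andP[+ _].
  move: Au; rewrite /A /=; set a := Re _; set b := Re _; set e := _ / _.
  by move=> ca; rewrite lerBrDr => eb; rewrite (lt_le_trans _ eb)// addrC ltrBrDr.
move=> cK.
(* The gap [g] has to exceed 2 |eta u| / (j + 1): one half is the margin required in [A i j], the
   other is lost on replacing [phi y] by [s i]. The extra 1 in the divisor keeps it positive when
   [eta u] is 0. *)
pose g := Re (dot (phi y) (eta u)) - c.
have g0 : 0 < g by rewrite subr_gt0.
have h0 : 0 < 2 * hnorm (eta u) + 1 by have := hnorm_ge0 (eta u); lra.
have /ltr_add_invr[j] : 0 < g / (2 * hnorm (eta u) + 1) by rewrite divr_gt0.
rewrite add0r => jg.
have j0 : 0 < j.+1%:R^-1 :> R by rewrite invr_gt0.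
have [i iy] := s_dense (phi y) j0.
exists i => //; exists j => //; split; rewrite /A /B /=; last exact: ltW.
have := close _ _ (eta u) _ (ltW iy); rewrite ler_norml => /andP[_].
move: jg; rewrite ltr_pdivlMr// /g; move: j0.
by set q := j.+1%:R^-1 => q0; have := hnorm_ge0 (eta u); nra.
Qed.

Lemma cmeasurable_dot2 (phi : T2 -> H) (eta : T1 -> H) :
  weakly_measurable phi -> weakly_measurable eta ->
  cmeasurable (fun p : T1 * T2 => dot (phi p.2) (eta p.1)).
Proof.
move=> mphi meta; split; first exact: measurable_Re_dot.
(* Im w = Re (- i w), and the product is linear in its first slot. *)
have mphi' : weakly_measurable (fun y => (- 'i%C)%R *: phi y).
  move=> f; under eq_fun do rewrite dotZr.
  exact: cmeasurableM (cmeasurable_cst _ _) (mphi f).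
have := measurable_Re_dot mphi' meta.
congr (measurable_fun _ _); apply/funext => p /=.
rewrite dotZl; case: (dot _ _) => a b /=.
by rewrite oppr0 mul0r add0r mulN1r opprK.
Qed.

End joint_measurability.

End hilbert_space.

(** * The weighted norm of H^1_v and its separability *)

Lemma cvge0_lt (R : realType) (u : nat -> \bar R) (e : R) :
  (u n @[n --> \oo] --> 0)%E -> 0 < e ->
  exists N, forall n, (N <= n)%N -> (u n < e%:E)%E.
Proof.
move=> u0 e0; have e0' : ((0 : \bar R) < e%:E)%E by rewrite lte_fin.
by have [N _ uN] := u0 _ (open_ereal_lt' e0'); exists N.
Qed.

Section weighted_norm.
Context d (T : measurableType d) (R : realType).
Variable mu : {measure set T -> \bar R}.
Context (H : completeNormedModType R[i]).
Variable dot : {dot H for Num.conj}.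
Hypothesis H_hilbert : hilbert dot.
Variable s : nat -> H.
Hypothesis s_dense : forall f (e : R), 0 < e -> exists n, hnorm (f - s n) < e.
Variables (v : T -> R) (eta : T -> H).
Hypothesis mv : measurable_fun setT v.
Hypothesis v_ge0 : forall x, 0 <= v x.
Hypothesis meta : weakly_measurable dot eta.
Implicit Types f g : H.
Local Open Scope ereal_scope.

Definition wnorm f : \bar R := \int[mu]_x (normc (dot f (eta x)) * v x)%:E.

Let wE f x : \bar R := (normc (dot f (eta x)) * v x)%:E.

Let wE_ge0 f x : 0 <= wE f x.
Proof. by rewrite lee_fin mulr_ge0// normc_ge0. Qed.

Let measurable_wE f : measurable_fun setT (wE f).
Proof.
by apply/measurable_EFinP/measurable_funM => //; exact: measurable_normc.
Qed.

Lemma wnorm_ge0 f : 0 <= wnorm f.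
Proof. by apply: integral_ge0 => x _; exact: wE_ge0. Qed.

Lemma wnormD f g : wnorm (f + g)%R <= wnorm f + wnorm g.
Proof.
have mw := measurable_wE; rewrite /wnorm -/(wE f) -/(wE g).
rewrite -(ge0_integralD mu measurableT (fun x _ => wE_ge0 f x) (mw f)
  (fun x _ => wE_ge0 g x) (mw g)).
apply: (ge0_le_integral mu measurableT (fun x _ => wE_ge0 _ x) (mw _)).
  exact: emeasurable_funD.
move=> x _; rewrite -EFinD lee_fin -mulrDl ler_wpM2r// (dotDl dot).
exact: normc_triangle.
Qed.

Lemma wnormZ a f : wnorm (a *: f)%R = (normc a)%:E * wnorm f.
Proof.
rewrite -(ge0_integralZl mu measurableT (measurable_wE f)
  (fun x _ => wE_ge0 f x)) ?lee_fin ?normc_ge0//.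
by apply: eq_integral => x _; rewrite (dotZl dot) Normc.normcM -mulrA EFinM.
Qed.

Lemma wnorm0 : wnorm 0%R = 0.
Proof. by rewrite -(scale0r (0%R : H)) wnormZ Normc.normc0 mul0e. Qed.

Lemma wnorm0_lty : wnorm 0%R < +oo.
Proof. by rewrite wnorm0. Qed.

Lemma wnorm_lin_lty a f g : wnorm f < +oo -> wnorm g < +oo ->
  wnorm (a *: f + g)%R < +oo.
Proof.
move=> fy gy; apply: le_lt_trans (wnormD _ _) _; apply: lte_add_pinfty => //.
by rewrite wnormZ lte_mul_pinfty// lee_fin normc_ge0.
Qed.

Lemma wnorm_sum_lty n (a : nat -> R[i]) (e : nat -> H) :
  (forall i, wnorm (e i) < +oo) -> wnorm (\sum_(i < n) a i *: e i)%R < +oo.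
Proof.
move=> ey; elim: n => [|n IH]; first by rewrite big_ord0 wnorm0_lty.
by rewrite big_ord_recr /= addrC; exact: wnorm_lin_lty.
Qed.

Lemma wnorm_fin f : wnorm f < +oo -> wnorm f = (fine (wnorm f))%:E.
Proof. by move=> fy; rewrite fineK// ge0_fin_numE// wnorm_ge0. Qed.

(* Scheffe's argument: [|a| + |a - a_n| - |a_n|] lies between [0] and [2 |a|]
   and tends to [0]. *)
Lemma wnorm_cvg f (g : nat -> H) (e : R) : wnorm f < +oo -> (0 < e)%R ->
  (forall n, hnorm (f - g n) <= 2 / n.+1%:R)%R ->
  (forall n, wnorm (g n) <= wnorm f + (n.+1%:R^-1)%:E) ->
  exists n, wnorm (f - g n)%R < e%:E.
Proof.
move=> fy e0 fg ng.
pose p n x : R := (normc (dot f (eta x)) * v x +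
  normc (dot (f - g n) (eta x)) * v x - normc (dot (g n) (eta x)) * v x)%R.
have p_ge0 n x : (0 <= p n x)%R.
  rewrite /p -mulrDl -mulrBl mulr_ge0// subr_ge0 (dotBl dot).
  apply: le_trans (_ : normc (dot f (eta x) -
    (dot f (eta x) - dot (g n) (eta x))) <= _)%R; first by rewrite subKr.
  by apply: le_trans (normc_triangle _ _) _; rewrite normcN.
have p_le n x : (p n x <= 2 * (normc (dot f (eta x)) * v x))%R.
  rewrite /p -mulrDl -mulrBl mulrA ler_wpM2r// (dotBl dot).
  rewrite mulr2n mulrDl mul1r lerBlDr -addrA lerD2l.
  by apply: le_trans (normc_triangle _ _) _; rewrite normcN.
(* Two bounds with two roles: the previous one is an integrable majorant independent of [n]; this
   one, from Cauchy-Schwarz and closeness in H, gives convergence to 0 at each [x]. *)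
have p_le2 n x : (p n x <= 2 * (2 / n.+1%:R * hnorm (eta x) * v x))%R.
  rewrite mulrA /p -mulrDl -mulrBl ler_wpM2r//.
  have b_le : (normc (dot (f - g n) (eta x)) <= 2 / n.+1%:R * hnorm (eta x))%R.
    apply: le_trans (cauchy_schwarz H_hilbert _ _) _.
    by rewrite ler_wpM2r ?hnorm_ge0.
  have : (normc (dot f (eta x)) <= normc (dot (f - g n) (eta x)) +
      normc (dot (g n) (eta x)))%R.
    apply: le_trans (normc_triangle _ _).
    by rewrite -(dotDl dot) subrK.
  move: b_le; set a := normc _; set b := normc (dot f _); set c := normc _.
  by set u := (_ * _)%R; lra.
have mp n : measurable_fun setT (fun x => (p n x)%:E).
  apply/measurable_EFinP; apply: measurable_funB; last first.
    by apply/measurable_EFinP; exact: measurable_wE.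
  by apply: measurable_funD; apply/measurable_EFinP; exact: measurable_wE.
have p_cvg x : p n x @[n --> \oo] --> 0%R.
  apply: (@squeeze_cvgr _ _ _ _ (fun=> 0%R)
    (fun n => (2 * 2 * hnorm (eta x) * v x) * n.+1%:R^-1)%R).
  - near=> n; rewrite p_ge0 /=; apply: le_trans (p_le2 n x) _.
    by rewrite le_eqVlt; apply/orP; left; apply/eqP; ring.
  - exact: cvg_cst.
  - rewrite -[X in _ --> X](mulr0 (2 * 2 * hnorm (eta x) * v x)%R).
    by apply: cvgM; [exact: cvg_cst|exact: cvg_harmonic].
have int2 : mu.-integrable setT (fun x => 2%:E * wE f x).
  apply: integrableZl => //; apply/integrableP; split; first exact: measurable_wE.
  by under eq_integral do rewrite gee0_abs//.
have p_cvgE : {ae mu, forall x, setT x -> (p n x)%:E @[n --> \oo] --> cst 0 x}.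
  by apply: aeW => x _; apply: cvg_EFin; [exact: nearW|exact: p_cvg].
have p_dom : {ae mu, forall x n, setT x -> `|(p n x)%:E| <= 2%:E * wE f x}.
  apply: aeW => x n _; rewrite gee0_abs; last by rewrite lee_fin.
  by rewrite /wE -EFinM lee_fin; exact: p_le.
have [_ _] := dominated_convergence measurableT mp (measurable_cst _) p_cvgE
  int2 p_dom.
rewrite integral0 => P_cvg.
have e2 : (0 < e / 2)%R by rewrite divr_gt0.
have [N PN] := cvge0_lt P_cvg e2.
have /ltr_add_invr[M] := e2; rewrite add0r => eM.
exists (maxn N M); set n := maxn N M.
have Pn : \int[mu]_x (p n x)%:E < (e / 2)%:E by apply: PN; exact: leq_maxl.
(* Solved for the norm of [f - g n], this leaves the integral of [p n] plus the excess of the norm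
   of [g n] over that of [f], each below e / 2. It is kept as an identity of sums because the terms
   are extended reals. *)
have eq : wnorm f + wnorm (f - g n)%R = \int[mu]_x (p n x)%:E + wnorm (g n).
  rewrite /wnorm -(ge0_integralD mu measurableT (fun x _ => wE_ge0 f x)
    (measurable_wE f) (fun x _ => wE_ge0 (f - g n)%R x) (measurable_wE _)).
  have pE_ge0 x : setT x -> 0 <= (p n x)%:E by rewrite lee_fin.
  rewrite -(ge0_integralD mu measurableT pE_ge0 (mp n)
    (fun x _ => wE_ge0 (g n) x) (measurable_wE _)).
  by apply: eq_integral => x _; rewrite -!EFinD; congr _%:E; rewrite /p subrK.
have nM : (n.+1%:R^-1 < e / 2)%R.
  apply: le_lt_trans eM; rewrite lef_pV2 ?posrE//.
  by rewrite ler_nat ltnS leq_maxr.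
have P_ge0 : 0 <= \int[mu]_x (p n x)%:E by apply: integral_ge0 => x _; rewrite lee_fin.
move: eq Pn P_ge0 (ng n) (wnorm_ge0 (g n)) (wnorm_ge0 (f - g n)%R).
rewrite (wnorm_fin fy); move: (fine _) => a.
move: (wnorm _) (wnorm _) (integral _ _ _) nM => [b| |] [c| |] [q| |]//.
move: (n.+1%:R^-1)%R => w we; rewrite -!EFinD => -[bq].
by rewrite !lte_fin !lee_fin => qe q0 cw c0 b0; lra.
Unshelve. all: by end_near. Qed.

(** The points of [s] need not have finite weighted norm, and closeness in H does not control that
    norm. So finite-norm vectors are sorted into countably many cells: [i] locates the vector in H,
    [j] is the precision, [l] is its weighted norm in units of 1 / (j + 1). One vector is chosen in
    each nonempty cell. Vectors of a common cell are 2 / (j + 1)-close in H and have norms differing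
    by at most 1 / (j + 1), as Scheffe's argument requires. *)
Lemma wnorm_separable : exists e : nat -> H,
  (forall i, wnorm (e i) < +oo) /\
  forall f (r : R), wnorm f < +oo -> (0 < r)%R -> exists i, wnorm (f - e i)%R < r%:E.
Proof.
pose P (t : nat * nat * nat) f : Prop := let: (i, j, l) := t in
  [/\ wnorm f < +oo, (hnorm (f - s i) <= j.+1%:R^-1)%R,
      (l%:R <= fine (wnorm f) * j.+1%:R)%R &
      (fine (wnorm f) * j.+1%:R <= l.+1%:R)%R].
(* The defaults are harmless: an empty cell yields 0, whose norm is finite, and an integer that
   codes no triple is read as (0, 0, 0). *)
pose e k := xget 0%R (P (odflt (0%N, 0%N, 0%N) (unpickle k))).
exists e; split.
  move=> k; rewrite /e; case: xgetP => [h _|_]; last exact: wnorm0_lty.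
  by case: (odflt _ _) => [[i j] l] [].
move=> f r fy r0.
suff /choice[k ek] : forall n, exists k, (hnorm (f - e k) <= 2 / n.+1%:R)%R /\
    wnorm (e k) <= wnorm f + (n.+1%:R^-1)%:E.
  have [n fn] := @wnorm_cvg f (e \o k) r fy r0
    (fun n => proj1 (ek n)) (fun n => proj2 (ek n)).
  by exists (k n).
move=> n; have n0 : (0 < n.+1%:R^-1 :> R)%R by rewrite invr_gt0.
have [i fi] := s_dense f n0.
pose l := Num.truncn (fine (wnorm f) * n.+1%:R)%R.
have l0 : (0 <= fine (wnorm f) * n.+1%:R)%R.
  by rewrite mulr_ge0// fine_ge0// wnorm_ge0.
have Pf : P (i, n, l) f.
  by have /andP[l1 /ltW l2] := truncn_itv l0; split => //; exact: ltW.
exists (pickle (i, n, l)); rewrite /e pickleK /=; case: xgetP; last first.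
  by move=> /(_ f).
move=> g _ [gy gi gl1 gl2]; split.
  have -> : (f - g = (f - s i) + (s i - g))%R by rewrite addrA subrK.
  apply: le_trans (ler_hnormD _ _) _; rewrite (hnormB (s i)).
  by rewrite mulr2n mulrDl mul1r lerD// ltW.
rewrite (wnorm_fin gy) (wnorm_fin fy) -EFinD lee_fin.
rewrite -(ler_pM2r (ltr0Sn _ n)) mulrDl mulVf//.
apply: le_trans gl2 _; rewrite -natr1 lerD2r.
by case: Pf.
Qed.

End weighted_norm.

(** * The reproducing formula on the antidual *)

Section reproducing_formula.
Context d (T : measurableType d) (R : realType).
Variable mu : {sigma_finite_measure set T -> \bar R}.
Context (H : completeNormedModType R[i]).
Variable dot : {dot H for Num.conj}.
Hypothesis H_hilbert : hilbert dot.
Variable s : nat -> H.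
Hypothesis s_dense : forall f (e : R), 0 < e -> exists n, hnorm (f - s n) < e.
Variables (v : T -> R) (phi eta : T -> H).
Hypothesis mv : measurable_fun setT v.
Hypothesis v_ge1 : forall x, 1 <= v x.
Hypothesis mphi : weakly_measurable dot phi.
Hypothesis meta : weakly_measurable dot eta.
Implicit Types f g : H.
Local Open Scope ereal_scope.
Local Notation wnorm := (wnorm mu dot v eta).

Let v_ge0 x : (0 <= v x)%R.
Proof. exact: le_trans (v_ge1 x). Qed.

Lemma measurable_weighted_dot2 (psi : T -> H) : weakly_measurable dot psi ->
  measurable_fun setT (fun p : T * T =>
    (normc (dot (psi p.2) (eta p.1)) * v p.1)%:E).
Proof.
move=> mpsi; apply/measurable_EFinP; apply: measurable_funM.
  exact/measurable_normc/(cmeasurable_dot2 H_hilbert s_dense).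
exact: measurableT_comp.
Qed.

Lemma measurable_wnorm (psi : T -> H) : weakly_measurable dot psi ->
  measurable_fun setT (fun y => wnorm (psi y)).
Proof.
move=> mpsi; apply: (measurable_fun_fubini_tonelli_G _
  (measurable_weighted_dot2 mpsi)).
by move=> p; rewrite lee_fin mulr_ge0// normc_ge0.
Qed.

Definition simple_fun n (D : nat -> set T) (e : nat -> H) (y : T) : H :=
  (\sum_(i < n) (\1_(D i) y)%:C%C *: e i)%R.

Lemma weakly_measurable_simple n (D : nat -> set T) (e : nat -> H) :
  (forall i, measurable (D i)) -> weakly_measurable dot (simple_fun n D e).
Proof.
move=> mD f; under eq_fun do rewrite dotC.
apply: cmeasurable_conj; under eq_fun do rewrite dot_suml.
apply: cmeasurable_sum => i; under eq_fun do rewrite dotZl.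
apply: cmeasurableM; first exact: cmeasurable_indic.
exact: cmeasurable_cst.
Qed.

Lemma weakly_measurable_sub (phi1 phi2 : T -> H) :
  weakly_measurable dot phi1 -> weakly_measurable dot phi2 ->
  weakly_measurable dot (fun y => phi1 y - phi2 y)%R.
Proof.
move=> m1 m2 f; under eq_fun do rewrite dotBr.
exact: cmeasurableB (m1 f) (m2 f).
Qed.

Lemma simple_fun_in n (D : nat -> set T) e i y : trivIset setT D ->
  (i < n)%N -> D i y -> simple_fun n D e y = e i.
Proof.
move=> tD ltin Diy; rewrite /simple_fun (bigD1 (Ordinal ltin)) //= big1 ?addr0.
  by rewrite indicE mem_set// scale1r.
move=> j ji; rewrite indicE memNset ?scale0r// => Djy.
have : val j = i by apply: tD => //; exists y.
by move=> jE; move/eqP: ji; apply; exact: val_inj.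
Qed.

Lemma simple_fun_out n (D : nat -> set T) e y :
  (forall i, (i < n)%N -> ~ D i y) -> simple_fun n D e y = 0%R.
Proof.
move=> nD; rewrite /simple_fun big1// => i _.
by rewrite indicE memNset ?scale0r//; exact: nD.
Qed.

(** Balls of radius [del] around a dense sequence of E, made disjoint, cover almost every value of
    [phi]. On the first [n] pieces the error is below [del]; on the remaining set [E n] the simple
    function is 0 and the error is the norm of [phi] itself, whose integral against [k] tends to 0
    by dominated convergence. *)
Lemma simple_approximation (k : T -> R) (r : R) :
  measurable_fun setT k -> (forall y, 0 <= k y)%R ->
  \int[mu]_y (k y)%:E < +oo -> \int[mu]_y ((k y)%:E * wnorm (phi y)) < +oo ->
  {ae mu, forall y, wnorm (phi y) < +oo} -> (0 < r)%R ->
  exists n D e, [/\ forall i, measurable (D i), forall i, wnorm (e i) < +oo &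
    \int[mu]_y ((k y)%:E * wnorm (phi y - simple_fun n D e y)%R) <= r%:E].
Proof.
move=> mk k0 ky kNy aeN r0.
have [e [ey e_dense]] := wnorm_separable mu H_hilbert s_dense mv v_ge0 meta.
pose kk := fine (\int[mu]_y (k y)%:E).
have kkE : \int[mu]_y (k y)%:E = kk%:E.
  by rewrite fineK// ge0_fin_numE// integral_ge0// => y _; rewrite lee_fin.
have kk0 : (0 <= kk)%R by rewrite fine_ge0// integral_ge0// => y _; rewrite lee_fin.
(* The covered part contributes at most del * kk <= r / 2; the 1 guards against kk = 0. *)
pose del : R := (r / 2 / (kk + 1))%R.
have kk1 : (0 < kk + 1)%R by rewrite ltr_wpDl.
have del0 : (0 < del)%R by rewrite !divr_gt0.
pose B i := [set y | wnorm (phi y - e i)%R < del%:E].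
pose D := seqDU B.
have mB i : measurable (B i).
  rewrite -[B i]setTI; apply: emeasurable_fun_infty_o => //.
  exact/measurable_wnorm/weakly_measurableB.
have mD i : measurable (D i).
  by rewrite /D /seqDU; apply: measurableD => //; apply: bigsetU_measurable.
pose E n := ~` (\big[setU/set0]_(i < n) D i).
have mE n : measurable (E n).
  by apply: measurableC; apply: bigsetU_measurable.
have mN : measurable_fun setT (fun y => (k y)%:E * wnorm (phi y)).
  by apply: emeasurable_funM; [exact/measurable_EFinP|exact: measurable_wnorm].
have kN0 y : 0 <= (k y)%:E * wnorm (phi y).
  by rewrite mule_ge0 ?lee_fin// wnorm_ge0.
pose G n y := (k y)%:E * wnorm (phi y) * (\1_(E n) y)%:E.
have G0 n y : 0 <= G n y by rewrite mule_ge0// lee_fin.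
have mG n : measurable_fun setT (G n).
  by apply: emeasurable_funM => //; exact/measurable_EFinP/measurable_indic.
have G_cvg : {ae mu, forall y, setT y -> G n y @[n --> \oo] --> cst 0 y}.
  apply: filterS aeN => y Ny _; apply: (@cvg_near_cst _ _ _ _ _ _).
  (* Where [phi y] has finite norm, [y] belongs to some [D j], so [G n y] is 0 from n = j + 1 on. *)
  have [i Bi] := e_dense _ _ Ny del0.
  have : (\bigcup_k B k) y by exists i.
  rewrite seqDU_bigcup_eq => -[j _ Djy].
  exists j.+1 => // n /= jn; rewrite /G indicE memNset ?mule0//.
  by apply; rewrite -bigcup_mkord; exists j.
have G_int : mu.-integrable setT (fun y => (k y)%:E * wnorm (phi y)).
  by apply/integrableP; split => //; under eq_integral do rewrite gee0_abs//.
have G_dom : {ae mu, forall y n, setT y -> `|G n y| <= (k y)%:E * wnorm (phi y)}.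
  apply: aeW => y n _; rewrite gee0_abs//.
  by rewrite -[leRHS]mule1 lee_wpmul2l// lee_fin indicE; case: (_ \in _).
have [_ _] := dominated_convergence measurableT mG (measurable_cst _) G_cvg
  G_int G_dom.
rewrite integral0 => /cvge0_lt r2.
have r20 : (0 < r / 2)%R by rewrite divr_gt0.
have [n /(_ n (leqnn n)) Gn] := r2 _ r20.
exists n, D, e; split=> //.
apply: (@le_trans _ _ (\int[mu]_y (del%:E * (k y)%:E + G n y))).
  apply: ge0_le_integral => //.
  - by move=> y _; rewrite mule_ge0 ?lee_fin// wnorm_ge0.
  - apply: emeasurable_funM; first exact/measurable_EFinP.
    by apply/measurable_wnorm/weakly_measurable_sub => //; exact: weakly_measurable_simple.
  - by apply: emeasurable_funD => //; apply: emeasurable_funM => //; exact/measurable_EFinP.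
  move=> y _; have [|Eny] := pselect ((\big[setU/set0]_(i < n) D i) y).
    rewrite -bigcup_mkord => -[i /= ltin Diy].
    rewrite (simple_fun_in e (@trivIset_seqDU _ _) ltin Diy).
    apply: (@le_trans _ _ (del%:E * (k y)%:E)); last by rewrite leeDl.
    rewrite muleC lee_wpmul2r ?lee_fin// ltW//.
    by case: Diy.
  rewrite simple_fun_out ?subr0; last first.
    by move=> i ltin Diy; apply: Eny; rewrite -bigcup_mkord; exists i.
  rewrite /G indicE mem_set// mule1 leeDr// mule_ge0 ?lee_fin//.
  exact: ltW.
rewrite ge0_integralD//; last 2 first.
  by move=> y _; rewrite mule_ge0// lee_fin// ltW.
  by apply: emeasurable_funM => //; exact/measurable_EFinP.
rewrite ge0_integralZl//; last 3 first.
  exact/measurable_EFinP.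
  by move=> y _; rewrite lee_fin.
  by rewrite lee_fin ltW.
rewrite kkE (splitr r) EFinD; apply: leeD; last exact: ltW.
rewrite -EFinM lee_fin /del mulrAC -[leRHS]mulr1 -!mulrA ler_pM2l//.
by rewrite ler_pM2l ?invr_gt0// ler_pdivrMr// mul1r lerDl.
Qed.


(** Linearity is asked on E only, because functionals extended by zero are not linear on H. It is
    plain linearity: elements of the antidual are conjugated before they are used here. *)
Definition linear_on (E : set H) (l : H -> R[i]) : Prop :=
  forall a f g, E f -> E g -> l (a *: f + g)%R = (a * l f + l g)%R.

Local Notation Efin := [set f | wnorm f < +oo].

Lemma linear_on0 l : linear_on Efin l -> l 0%R = 0%R.
Proof.
have E0 : Efin 0%R by exact: wnorm0_lty.
move=> /(_ 1%R _ _ E0 E0); rewrite scale1r addr0 mul1r.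
by move/eqP; rewrite -subr_eq subrr => /eqP.
Qed.

Lemma EfinB f g : Efin f -> Efin g -> Efin (f - g)%R.
Proof.
by move=> fE gE; rewrite /= addrC -scaleN1r; exact: wnorm_lin_lty.
Qed.

Lemma linear_onB l f g : linear_on Efin l -> Efin f -> Efin g ->
  l (f - g)%R = (l f - l g)%R.
Proof.
move=> ll fE gE; have := ll (-1)%R g f gE fE.
by rewrite scaleN1r mulN1r addrC => ->; rewrite addrC.
Qed.

Lemma linear_on_sum l n (a : nat -> R[i]) (e : nat -> H) : linear_on Efin l ->
  (forall i, Efin (e i)) ->
  l (\sum_(i < n) a i *: e i)%R = (\sum_(i < n) a i * l (e i))%R.
Proof.
move=> ll Ee; elim: n => [|n IH]; first by rewrite !big_ord0 linear_on0.
rewrite !big_ord_recr /= addrC ll//; first by rewrite IH addrC.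
exact: wnorm_sum_lty.
Qed.

Lemma linear_on_dot u : linear_on Efin (fun f => dot f u).
Proof. by move=> a f g _ _; rewrite dotDl dotZl. Qed.

(** By linearity [l] passes through the integral of [h] times the simple function, so the difference
    is the integral of h (L - l q); the factor 2 is that of [normc_cintegral_le]. Both uses have L =
    l o phi: with l = <., eta x> to estimate vectors in E, and with the functional under study. *)
Lemma cintegral_simple (h L : T -> R[i]) l n (D : nat -> set T) (e : nat -> H) :
  cmeasurable h -> \int[mu]_y (normc (h y))%:E < +oo ->
  linear_on Efin l -> (forall i, measurable (D i)) -> (forall i, Efin (e i)) ->
  cintegrable mu (fun y => h y * L y)%R ->
  (normc (cintegral mu (fun y => h y * L y)%R -
    l (\sum_(i < n) cintegral mu (fun y => h y * (\1_(D i) y)%:C%C)%R *: e i)%R))%:E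
  <= 2%:E * \int[mu]_y (normc (h y) * normc (L y - l (simple_fun n D e y)))%:E.
Proof.
move=> mh hy ll mD Ee iL.
have ih i : cintegrable mu (fun y => h y * (\1_(D i) y)%:C%C)%R.
  apply: cintegrableP.
    by apply: cmeasurableM => //; exact: cmeasurable_indic.
  apply: le_lt_trans hy; apply: ge0_le_integral => //.
  - by move=> y _; rewrite lee_fin normc_ge0.
  - apply: measurable_normcE; apply: cmeasurableM => //.
    exact: cmeasurable_indic.
  - exact: measurable_normcE.
  - move=> y _; rewrite lee_fin Normc.normcM normcR.
    rewrite -[leRHS]mulr1 ler_wpM2l ?normc_ge0//.
    by rewrite indicE; case: (_ \in _); rewrite ?normr0 ?normr1.
rewrite (linear_on_sum n
  (fun i => cintegral mu (fun y => h y * (\1_(D i) y)%:C%C)%R) ll Ee).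
have [i1 i2] := cintegral_sum (index_enum 'I_n)
  (fun i : 'I_n => cintegrableZ (l (e i)) (ih i)).
have hlE : (fun y => \sum_(i < n) l (e i) * (h y * (\1_(D i) y)%:C%C))%R =
    (fun y => h y * l (simple_fun n D e y))%R.
  apply/funext => y; rewrite /simple_fun.
  rewrite (linear_on_sum _ (fun i => (\1_(D i) y)%:C%C)%R)// mulr_sumr.
  by apply: eq_bigr => i _; rewrite mulrC mulrA.
rewrite {}hlE in i1 i2.
have -> : (\sum_(i < n) cintegral mu (fun y => h y * (\1_(D i) y)%:C%C) * l (e i))%R
    = cintegral mu (fun y => h y * l (simple_fun n D e y))%R.
  by rewrite i2; apply: eq_bigr => i _; rewrite cintegralZ// mulrC.
rewrite -cintegralB//; have i3 := cintegrableB iL i1.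
apply: le_trans (normc_cintegral_le i3) _; rewrite le_eqVlt; apply/orP; left.
apply/eqP; congr (_ * _); apply: eq_integral => y _.
by rewrite -mulrBr Normc.normcM.
Qed.

(** Let q be a simple approximation of [phi] and gq the finite sum that integrates h q. Then [l gq]
    is close to both sides: to [l g] because g - gq is small in E and [l] is bounded there, and to
    the integral because [l] and the sum commute. The bound on the norm of [phi y] by C v(y) makes
    the integral of |h| |phi|_E finite, at most |C| times the norm of [g]. *)
Lemma reproducing_formula (C c : R) g l :
  {ae mu, forall y, wnorm (phi y) <= (C * v y)%:E} -> Efin g ->
  (forall u, cintegrable mu (fun y => dot g (eta y) * dot (phi y) u)%R /\
     dot g u = cintegral mu (fun y => dot g (eta y) * dot (phi y) u)%R) ->
  linear_on Efin l -> cmeasurable (fun y => l (phi y)) ->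
  (forall f, Efin f -> (normc (l f))%:E <= c%:E * wnorm f) ->
  cintegrable mu (fun y => dot g (eta y) * l (phi y))%R /\
  l g = cintegral mu (fun y => dot g (eta y) * l (phi y))%R.
Proof.
move=> aeC gE weak ll ml lc.
wlog c0 : c lc / (0 <= c)%R.
  move=> /(_ `|c|%R); apply => // f fE; apply: le_trans (lc f fE) _.
  by rewrite lee_wpmul2r ?wnorm_ge0// lee_fin ler_norm.
pose h y := dot g (eta y); have mh : cmeasurable h by exact: meta.
have mnh : measurable_fun setT (fun y => normc (h y)) by exact: measurable_normc.
have nh0 y : (0 <= normc (h y))%R by exact: normc_ge0.
have hv y : (normc (h y))%:E <= (normc (h y) * v y)%:E.
  by rewrite lee_fin ler_peMr.
have hy : \int[mu]_y (normc (h y))%:E < +oo.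
  apply: le_lt_trans gE; apply: ge0_le_integral => //.
  - by move=> y _; rewrite lee_fin.
  - exact/measurable_EFinP.
  - by apply/measurable_EFinP; exact: measurable_funM.
  - by move=> y _; exact: hv.
have mN := measurable_wnorm mphi.
have C0v y : (C * v y)%:E <= (`|C| * v y)%:E.
  by rewrite lee_fin ler_wpM2r// ler_norm.
have hNy : \int[mu]_y ((normc (h y))%:E * wnorm (phi y)) < +oo.
  apply: (@le_lt_trans _ _ (\int[mu]_y (`|C|%:E * (normc (h y) * v y)%:E))).
    apply: ae_ge0_le_integral => //.
    - by move=> y _; rewrite mule_ge0 ?lee_fin// wnorm_ge0.
    - by apply: emeasurable_funM => //; exact/measurable_EFinP.
    - by move=> y _; rewrite mule_ge0// lee_fin// mulr_ge0.
    - apply: emeasurable_funM => //.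
      by apply/measurable_EFinP; exact: measurable_funM.
    - apply: filterS aeC => y Cy _.
      rewrite EFinM muleCA lee_wpmul2l ?lee_fin// -EFinM.
      exact: le_trans (C0v y).
  rewrite ge0_integralZl//; last 2 first.
    by apply/measurable_EFinP; exact: measurable_funM.
    by move=> y _; rewrite lee_fin mulr_ge0.
  by apply: lte_mul_pinfty; rewrite ?lee_fin//; exact: gE.
have aeN : {ae mu, forall y, wnorm (phi y) < +oo}.
  by apply: filterS aeC => y Cy; apply: le_lt_trans Cy _; exact: ltry.
have il : cintegrable mu (fun y => h y * l (phi y))%R.
  apply: cintegrableP; first exact: cmeasurableM.
  apply: (@le_lt_trans _ _ (\int[mu]_y (c%:E * ((normc (h y))%:E * wnorm (phi y))))).
    apply: ae_ge0_le_integral => //.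
    - by move=> y _; rewrite lee_fin normc_ge0.
    - by apply: measurable_normcE; exact: cmeasurableM.
    - by move=> y _; rewrite !mule_ge0 ?lee_fin// wnorm_ge0.
    - apply: emeasurable_funM => //; apply: emeasurable_funM => //.
      exact/measurable_EFinP.
    - apply: filterS aeN => y Ny _.
      by rewrite Normc.normcM EFinM muleCA lee_wpmul2l ?lee_fin//; exact: lc.
  rewrite ge0_integralZl//; last 2 first.
    by apply: emeasurable_funM => //; exact/measurable_EFinP.
    by move=> y _; rewrite mule_ge0 ?lee_fin// wnorm_ge0.
  by rewrite lte_mul_pinfty// lee_fin.
split=> //; apply/eqP; rewrite -subr_eq0; apply/eqP/Normc.eq0_normc/eqP.
rewrite eq_le normc_ge0 andbT; apply/ler_addgt0Pr => r r0; rewrite add0r.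
have c41 : (0 < 4 * c + 1)%R by rewrite ltr_wpDl ?mulr_ge0.
(* Each of the two errors is at most 2 c times the tolerance, 2 from the modulus of a complex
   integral and c from the bound on [l]; together they stay below [r], also when c = 0. *)
have r40 : (0 < r / (4 * c + 1))%R by rewrite divr_gt0.
have [n [D [e [mD eE De]]]] := simple_approximation mnh nh0 hy hNy aeN r40.
set q := simple_fun n D e in De.
pose gq : H := (\sum_(i < n) cintegral mu (fun y => h y * (\1_(D i) y)%:C%C)%R *: e i)%R.
have gqE : Efin gq by exact: (wnorm_sum_lty mv v_ge0 meta n
  (fun i => cintegral mu (fun y => h y * (\1_(D i) y)%:C%C)%R) eE).
have qE y : Efin (q y) by exact: (wnorm_sum_lty mv v_ge0 meta n
  (fun i => (\1_(D i) y)%:C%C) eE).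
have mphiq : weakly_measurable dot (fun y => phi y - q y)%R.
  by apply: weakly_measurable_sub => //; exact: weakly_measurable_simple.
(* The weak formula is tested against each [eta x] and integrated in [x] with weight [v]; Tonelli
   turns the double integral into the quantity that the simple approximation makes small. *)
have g_gq : wnorm (g - gq)%R <= 2%:E * (r / (4 * c + 1))%:E.
  pose F (p : T * T) : \bar R := (normc (h p.2) *
    (normc (dot (phi p.2 - q p.2) (eta p.1)) * v p.1))%:E.
  have F0 p : 0 <= F p by rewrite lee_fin !mulr_ge0// normc_ge0.
  have mF : measurable_fun setT F.
    apply/measurable_EFinP; apply: measurable_funM; first exact: (measurableT_comp mnh measurable_snd).
    by apply/measurable_EFinP; exact: (measurable_weighted_dot2 mphiq).
  apply: (@le_trans _ _ (\int[mu]_x (2%:E * \int[mu]_y F (x, y)))).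
    apply: ge0_le_integral => //.
    - by move=> x _; rewrite lee_fin mulr_ge0// normc_ge0.
    - apply/measurable_EFinP; apply: measurable_funM => //.
      exact/measurable_normc.
    - apply: emeasurable_funM => //.
      exact: (measurable_fun_fubini_tonelli_F _ mF F0).
    move=> x _; have [iw dw] := weak (eta x).
    have := cintegral_simple n mh hy (linear_on_dot (eta x)) mD eE iw.
    rewrite -/gq -dw -dotBl => le2.
    rewrite EFinM; apply: (@le_trans _ _ (2%:E *
        \int[mu]_y (normc (h y) * normc (dot (phi y) (eta x) - dot (q y) (eta x)))%:E
        * (v x)%:E)).
      by rewrite lee_wpmul2r// lee_fin.
    rewrite -muleA lee_wpmul2l// -ge0_integralZr//; last 3 first.
    - apply/measurable_EFinP; apply: measurable_funM => //.
      apply: measurable_normc; have := weakly_measurableC (eta x) mphiq.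
      by under eq_fun do rewrite dotBl.
    - by move=> y _; rewrite lee_fin mulr_ge0// normc_ge0.
    - by rewrite lee_fin.
    rewrite le_eqVlt; apply/orP; left; apply/eqP; apply: eq_integral => y _.
    by rewrite /F /= -EFinM dotBl mulrA.
  rewrite ge0_integralZl//; last 2 first.
    exact: (measurable_fun_fubini_tonelli_F _ mF F0).
    by move=> x _; exact: integral_ge0.
  rewrite lee_wpmul2l// fubini_tonelli//.
  apply: le_trans De; rewrite le_eqVlt; apply/orP; left; apply/eqP.
  apply: eq_integral => y _; rewrite /F /=.
  under eq_integral do rewrite EFinM.
  rewrite ge0_integralZl// ?lee_fin//.
  - have := measurable_pair2 y; move=> mp.
    apply/measurable_EFinP; apply: measurable_funM => //.
    exact/measurable_normc.
  - by move=> x _; rewrite lee_fin mulr_ge0// normc_ge0.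
have l_gq : (normc (cintegral mu (fun y => h y * l (phi y))%R - l gq))%:E <=
    (2 * c * (r / (4 * c + 1)))%:E.
  apply: le_trans (cintegral_simple n mh hy ll mD eE il) _.
  rewrite -mulrA EFinM lee_wpmul2l//.
  apply: (@le_trans _ _ (\int[mu]_y (c%:E *
      ((normc (h y))%:E * wnorm (phi y - q y)%R)))).
    apply: ae_ge0_le_integral => //.
    - by move=> y _; rewrite lee_fin mulr_ge0// normc_ge0.
    - apply/measurable_EFinP; apply: measurable_funM => //.
      apply: measurable_normc; apply: cmeasurableB => //.
      rewrite (_ : (fun _ => _) =
         (fun y => \sum_(i < n) (\1_(D i) y)%:C%C * l (e i))%R); last first.
        apply/funext => y.
        by rewrite /simple_fun (linear_on_sum _ (fun i => (\1_(D i) y)%:C%C)%R).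
      apply: cmeasurable_sum => i; apply: cmeasurableM.
        exact: cmeasurable_indic.
      exact: cmeasurable_cst.
    - by move=> y _; rewrite !mule_ge0 ?lee_fin// wnorm_ge0.
    - apply: emeasurable_funM => //; apply: emeasurable_funM.
        exact/measurable_EFinP.
      exact: measurable_wnorm.
    - apply: filterS aeN => y Ny _.
      rewrite EFinM muleCA lee_wpmul2l ?lee_fin// -(linear_onB ll Ny (qE y)).
      by apply: lc; exact: EfinB (qE y).
  rewrite ge0_integralZl//; last 2 first.
  - by apply: emeasurable_funM; [exact/measurable_EFinP|exact: measurable_wnorm].
  - by move=> y _; rewrite mule_ge0 ?lee_fin// wnorm_ge0.
  by rewrite EFinM lee_wpmul2l.
have lg : (normc (l (g - gq)%R))%:E <= (2 * c * (r / (4 * c + 1)))%:E.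
  apply: le_trans (lc _ _) _.
    exact: EfinB.
  by rewrite mulrAC mulrC EFinM lee_wpmul2l ?lee_fin// EFinM.
rewrite linear_onB// in lg.
have -> : (l g - cintegral mu (fun y => dot g (eta y) * l (phi y)) =
    (l g - l gq) - (cintegral mu (fun y => h y * l (phi y)) - l gq))%R.
  by rewrite opprB addrA subrK.
apply: le_trans (normc_triangle _ _) _; rewrite normcN.
move: lg l_gq; rewrite !lee_fin => lg l_gq.
apply: le_trans (lerD lg l_gq) _.
rewrite -mulrDl mulrA ler_pdivrMr// mulrC ler_pM2l//; lra.
Qed.

End reproducing_formula.

(** * Schur's test and Borel measurability *)

Section schur.
Context d (T : measurableType d) (R : realType).
Variable mu : {sigma_finite_measure set T -> \bar R}.
Context (H : completeNormedModType R[i]).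
Variable dot : {dot H for Num.conj}.
Hypothesis H_hilbert : hilbert dot.
Variable s : nat -> H.
Hypothesis s_dense : forall f (e : R), 0 < e -> exists n, hnorm (f - s n) < e.
Variable v : T -> R.
Hypothesis mv : measurable_fun setT v.
Hypothesis v_ge0 : forall x, 0 <= v x.

(** The weak identity g = \int <g, a_y> b_y dmu(y). Keeping [a] and [b] abstract lets a frame and
    its canonical dual exchange roles. *)
Definition dual_pair (a b : T -> H) : Prop := forall g u : H,
  cintegrable mu (fun y => dot g (a y) * dot (b y) u) /\
  dot g u = cintegral mu (fun y => dot g (a y) * dot (b y) u).

Lemma dual_pairC a b : dual_pair a b -> dual_pair b a.
Proof.
move=> ab g u; have [i1 i2] := ab u g.
have E : (fun y => dot g (b y) * dot (a y) u) =
    (fun y => Num.conj (dot u (a y) * dot (b y) g)).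
  by apply/funext => y; rewrite rmorphM /= -!dotC mulrC.
rewrite E cintegral_conj// -i2 -dotC; split=> //.
apply: cintegrableP; first exact/cmeasurable_conj/(cintegrable_cmeasurable i1).
by under eq_integral do rewrite normc_conj; exact: cintegrable_normc.
Qed.

(** Since f = \int <f, b_y> a_y weakly, <f, a_x> is the Gramian of [a] applied to <f, b_.>. After
    Tonelli the inner integral is the weighted norm of [a y], at most C v(y): Schur's test in
    weighted L1. *)
Lemma wnorm_schur (a b : T -> H) (C : R) (f : H) :
  weakly_measurable dot a -> weakly_measurable dot b -> dual_pair b a ->
  0 <= C -> {ae mu, forall y, (wnorm mu dot v a (a y) <= (C * v y)%:E)%E} ->
  (wnorm mu dot v a f <= (2 * C)%:E * wnorm mu dot v b f)%E.
Proof.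
move=> ma mb ba C0 aeC.
pose h y := dot f (b y).
have mnh : measurable_fun setT (fun y => normc (h y)).
  exact/measurable_normc/mb.
pose F (p : T * T) : \bar R :=
  (normc (h p.2) * (normc (dot (a p.2) (a p.1)) * v p.1))%:E.
have F0 p : (0 <= F p)%E by rewrite lee_fin !mulr_ge0// normc_ge0.
have mF : measurable_fun setT F.
  apply/measurable_EFinP; apply: measurable_funM.
    exact: (measurableT_comp mnh measurable_snd).
  by apply/measurable_EFinP; exact: (measurable_weighted_dot2 H_hilbert s_dense).
apply: (@le_trans _ _ (\int[mu]_x (2%:E * \int[mu]_y F (x, y)))%E).
  apply: ge0_le_integral => //.
  - by move=> x _; rewrite lee_fin mulr_ge0// normc_ge0.
  - apply/measurable_EFinP; apply: measurable_funM => //.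
    exact/measurable_normc.
  - apply: emeasurable_funM => //.
    exact: (measurable_fun_fubini_tonelli_F _ mF F0).
  move=> x _; have [i1 ->] := ba f (a x).
  rewrite EFinM; apply: (@le_trans _ _ (2%:E *
      \int[mu]_y (normc (h y * dot (a y) (a x)))%:E * (v x)%:E)%E).
    by rewrite lee_wpmul2r ?lee_fin//; exact: normc_cintegral_le.
  rewrite -muleA lee_wpmul2l// -ge0_integralZr//; last 3 first.
  - exact/measurable_normcE/cintegrable_cmeasurable/i1.
  - by move=> y _; rewrite lee_fin normc_ge0.
  - by rewrite lee_fin.
  rewrite le_eqVlt; apply/orP; left; apply/eqP; apply: eq_integral => y _.
  by rewrite /F /= -EFinM Normc.normcM mulrA.
rewrite ge0_integralZl//; last 2 first.
  exact: (measurable_fun_fubini_tonelli_F _ mF F0).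
  by move=> x _; exact: integral_ge0.
rewrite EFinM -muleA lee_wpmul2l// fubini_tonelli//.
rewrite -ge0_integralZl//; last 2 first.
  apply/measurable_EFinP; apply: measurable_funM => //.
  by move=> y _; rewrite lee_fin mulr_ge0// normc_ge0.
apply: ae_ge0_le_integral => //.
- by move=> y _; exact: integral_ge0.
- exact: (measurable_fun_fubini_tonelli_G _ mF F0).
- by move=> y _; rewrite mule_ge0// lee_fin mulr_ge0// normc_ge0.
- by apply: emeasurable_funM => //; apply/measurable_EFinP; exact: measurable_funM.
apply: filterS aeC => y Cy _; rewrite /F /=.
under eq_integral do rewrite EFinM.
rewrite ge0_integralZl// ?lee_fin ?normc_ge0//; last 2 first.
- by apply/measurable_EFinP; apply: measurable_funM => //; exact/measurable_normc.
- by move=> x _; rewrite lee_fin mulr_ge0// normc_ge0.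
rewrite [(normc (h y) * v y)%:E]EFinM muleCA.
by rewrite lee_wpmul2l ?lee_fin ?normc_ge0.
Qed.

End schur.

(** * Borel sets and Radon measures *)

Section topological_measure.
Context (R : realType) (X : ptopologicalType).

Lemma borel_open (U : set X) : open U -> measurable (U : set (borel X)).
Proof. by move=> oU; apply: sub_sigma_algebra. Qed.

Lemma borel_compact (Q : set X) : hausdorff_space X -> compact Q ->
  measurable (Q : set (borel X)).
Proof.
move=> hX cQ; rewrite -[Q]setCK; apply: measurableC; apply: borel_open.
by apply: closed_openC; exact: compact_closed.
Qed.

Lemma borel_continuous (f : X -> R) : continuous f ->
  measurable_fun [set: borel X] f.
Proof.
move=> cf; apply: (measurability _ (RGenOInfty.measurableE R)) => //.
move=> /= _ [_ [a ->] <-]; rewrite setTI; apply: borel_open.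
by apply: open_comp; [move=> x _; exact: cf|exact: interval_open].
Qed.

Lemma borel_ccontinuous (f : X -> (R[i] : numFieldType)) : continuous f ->
  cmeasurable (f : borel X -> R[i]).
Proof.
move=> cf; split; apply: borel_continuous => x; apply/cvgrPdist_lt => e e0;
  have e0' : (0 < e%:C%C :> R[i]) by rewrite ltcR.
- move/cvgrPdist_lt: (cf x) => /(_ _ e0'); apply: filterS => y.
  rewrite normc_norm ltcR; apply: le_lt_trans.
  by rewrite (_ : Re (f x) - Re (f y) = Re (f x - f y)) ?Re_le_normc//;
    case: (f x) => ? ?; case: (f y).
- move/cvgrPdist_lt: (cf x) => /(_ _ e0'); apply: filterS => y.
  rewrite normc_norm ltcR; apply: le_lt_trans.
  by rewrite (_ : Im (f x) - Im (f y) = Im (f x - f y)) ?Im_le_normc//;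
    case: (f x) => ? ?; case: (f y).
Qed.

Lemma radon_sigma_finite (mu : {measure set (borel X) -> \bar R}) :
  hausdorff_space X -> sigma_compact X -> radon_measure mu ->
  sigma_finite setT mu.
Proof.
move=> hX [Q [cQ QX]] rmu; exists Q => // n; split.
  exact: borel_compact.
exact: (radon_compact rmu).
Qed.

End topological_measure.

(** Tonelli's theorem takes a bundled sigma-finite measure. An equality of measures, rather than of
    their values, allows [mu] to be substituted throughout the hypotheses of the theorem. *)
Lemma sigma_finite_measure_ex d (T : measurableType d) (R : realType)
    (mu : {measure set T -> \bar R}) : sigma_finite setT mu ->
  exists nu : {sigma_finite_measure set T -> \bar R},
    (nu : {measure set T -> \bar R}) = mu.
Proof.
move=> sf; have H1 := @isSFinite.Build d T R mu (sfinite_measure_sigma_finite sf).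
have H2 := @isSigmaFinite.Build d T R mu sf.
pose nu := HB.pack_for (SigmaFiniteMeasure.type T R) (Measure.sort mu) H1 H2.
exists nu; rewrite {}/nu.
by case: mu sf H1 H2 => mu [? ?] sf H1 H2.
Qed.

(** * Transfer between coorbit spaces *)

Section coorbit_spaces.
Context (R : realType) (X : ptopologicalType).
Hypothesis X_hausdorff : hausdorff_space X.
Variable mu : {sigma_finite_measure set (borel X) -> \bar R}.
Context (H : completeNormedModType R[i]).
Variable dot : {dot H for Num.conj}.
Hypothesis H_hilbert : hilbert dot.
Variable s : nat -> H.
Hypothesis s_dense : forall f (e : R), 0 < e -> exists n, hnorm (f - s n) < e.
Variable m : X -> X -> R.
Hypothesis m_adm : admissible m.
Variable z : X.
Local Notation v := (fun x => m x z).
Implicit Types a b : X -> H.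
Local Notation wm a := (weakly_measurable (T := borel X) dot a).
Local Notation wnorm a := (wnorm (T := borel X) mu dot v a).

Lemma weight_ge1 x : 1 <= v x.
Proof. exact: adm_ge1. Qed.

Lemma weight_ge0 x : 0 <= v x.
Proof. exact: le_trans (weight_ge1 x). Qed.

Lemma measurable_weight : measurable_fun [set: borel X] v.
Proof.
apply: borel_continuous => x.
apply: (@continuous_comp _ _ _ (fun x => (x, z)) (fun p => m p.1 p.2)).
  by apply: cvg_pair; [exact: cvg_id|exact: cvg_cst].
exact: (adm_continuous m_adm).
Qed.

Lemma wnorm_finE a f : (wnorm a f < +oo)%E -> wnorm a f = (fine (wnorm a f))%:E.
Proof. by apply: wnorm_fin; exact: weight_ge0. Qed.

Lemma H1P a f : wm a -> H1 mu dot a v f <-> (wnorm a f < +oo)%E.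
Proof. by move=> ma; split=> [[]//|]; split => //; exact: ma. Qed.

Lemma H1_normE a f : H1_norm mu dot a v f = fine (wnorm a f).
Proof. by []. Qed.

Lemma Am_ae (K : X -> X -> R[i]) : Am mu m K ->
  exists2 C : R, 0 <= C & {ae mu, forall y : borel X,
    (\int[mu]_x (normc (weighted m K x y))%:E <= C%:E)%E}.
Proof.
move=> [_]; rewrite /A1_norm gt_max => /andP[_ ey].
set es := ess_sup _ _ in ey.
have es_le : (es <= `|fine es|%:E)%E.
  by move: (es) ey => [r _| //|_]; rewrite ?leNye//= lee_fin ler_norm.
exists `|fine es| => //.
have aees := ess_sup_ge mu (fun y => \int[mu]_x (normc (weighted m K x y))%:E)%E.
by apply: (filterS _ aees) => y /le_trans; apply.
Qed.

(** From m(x, z) <= m(x, y) m(y, z), the weight v(x) splits into v(y) and the weight of the kernel,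
    leaving a column integral of the weighted Gramian. The essential supremum bounds it for almost
    every [y] only. *)
Lemma Am_wnorm a b : wm a -> wm b -> Am mu m (gramian dot a b) ->
  exists2 C : R, 0 <= C &
    {ae mu, forall y : borel X, (wnorm a (b y) <= (C * v y)%:E)%E}.
Proof.
move=> ma mb mAm; have [C C0 aeC] := Am_ae mAm; exists C => //.
case: mAm => mK _.
apply: (filterS _ aeC) => y Cy.
have mKy : measurable_fun [set: borel X]
    (fun x : borel X => (normc (weighted m (gramian dot a b) x y))%:E).
  apply: measurable_normcE.
  exact: (cmeasurable_comp (measurable_pair2 y) mK).
apply: (@le_trans _ _ (\int[mu]_x
    ((normc (weighted m (gramian dot a b) x y))%:E * (v y)%:E))%E).
  apply: ge0_le_integral => //.
  - by move=> x _; rewrite lee_fin mulr_ge0 ?normc_ge0 ?weight_ge0.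
  - apply/measurable_EFinP; apply: measurable_funM; last exact: measurable_weight.
    exact/measurable_normc/ma.
  - exact: emeasurable_funM.
  - move=> x _; rewrite -EFinM lee_fin /weighted Normc.normcM normcR -mulrA.
    rewrite ler_wpM2l ?normc_ge0// ger0_norm; last exact: le_trans (adm_ge1 m_adm _ _).
    exact: (adm_submult m_adm).
rewrite ge0_integralZr//; last 2 first.
  by move=> x _; rewrite lee_fin normc_ge0.
  by rewrite lee_fin weight_ge0.
by rewrite EFinM lee_wpmul2r// lee_fin weight_ge0.
Qed.

Lemma H1_sub a b : wm a -> wm b -> dual_pair mu dot b a ->
  Am mu m (gramian dot a a) ->
  exists2 C : R, 0 <= C & forall f, (wnorm b f < +oo)%E ->
    (wnorm a f < +oo)%E /\ H1_norm mu dot a v f <= C * H1_norm mu dot b v f.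
Proof.
move=> ma mb ba /(Am_wnorm ma ma)[C C0 aeC]; exists (2 * C).
  by rewrite mulr_ge0.
move=> f fy; rewrite !H1_normE.
have le := wnorm_schur H_hilbert s_dense measurable_weight weight_ge0 f ma mb ba C0 aeC.
have b_fin := wnorm_finE fy.
have afy : (wnorm a f < +oo)%E.
  by apply: le_lt_trans le _; rewrite b_fin -EFinM ltry.
split=> //; rewrite -lee_fin EFinM -b_fin.
by rewrite -(wnorm_finE afy).
Qed.

Variables (Y : set (X -> R[i])) (nY : (X -> R[i]) -> R).
Hypotheses (Y1 : solid_banach_space mu Y nY) (Y2 : Am_acts mu m Y nY).

(** Positivity follows from the seminorm axioms: 0 = nY (F - F) <= 2 nY F. *)
Lemma nY_ge0 F : Y F -> 0 <= nY F.
Proof.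
move=> YF; have Y0 : Y (fun x => 0).
  have := fs_linear Y1 (-1) YF YF; congr Y; apply/funext => x.
  by rewrite mulN1r addNr.
have YN : Y (fun x => -1 * F x).
  have := fs_linear Y1 (-1) YF Y0; congr Y; apply/funext => x.
  by rewrite addr0.
have := fs_normD Y1 YF YN.
rewrite (fs_normZ Y1)// normcN Normc.normc1 mul1r.
have -> : (fun x => F x + -1 * F x) = (fun x => 0 * F x).
  by apply/funext => x; rewrite mulN1r subrr mul0r.
by rewrite (fs_normZ Y1)// Normc.normc0 mul0r -mulr2n pmulrn_lge0.
Qed.

Lemma kernel_op_bounded (K : X -> X -> R[i]) : Am mu m K ->
  exists2 C : R, 0 <= C & forall F, Y F ->
    Y (kernel_op mu K F) /\ nY (kernel_op mu K F) <= C * nY F.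
Proof.
move=> AK; exists `|fine (Am_norm mu m K)| => // F YF.
have [_ YK nYK] := Y2 AK YF; split=> //; rewrite -lee_fin.
apply: le_trans nYK _; rewrite EFinM lee_wpmul2r ?lee_fin ?nY_ge0//.
case: AK => _; rewrite -/(Am_norm mu m K); case: (Am_norm _ _ _) => [r _||]//=.
  by rewrite lee_fin ler_norm.
by rewrite leNye.
Qed.

(** The reproducing formula is applied to the vector [b x] and to the conjugate of [f], which is
    linear; conjugating back turns the coefficient <b_x, b_y> into the Gramian entry <b_y, b_x>. The
    cross Gramian supplies the bound on [a y] in the norm defined through [b]. *)
Lemma antidual_reproducing a b (f : H -> R[i]) x : wm a -> wm b ->
  dual_pair mu dot b a -> Am mu m (gramian dot b a) ->
  antidual (H1 mu dot b v) (H1_norm mu dot b v) f ->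
  cmeasurable (fun y : borel X => f (a y)) -> (wnorm b (b x) < +oo)%E ->
  f (b x) = kernel_op mu (gramian dot b b) (fun y => f (a y)) x.
Proof.
move=> ma mb ba Aba [flin [c fbd] _] mfa bxy.
have [C C0 aeC] := Am_wnorm mb ma Aba.
pose l u := Num.conj (f u).
have lE : linear_on [set u | (wnorm b u < +oo)%E] l.
  move=> k u w /(H1P _ mb) uE /(H1P _ mb) wE.
  by rewrite /l flin// rmorphD rmorphM /= conjCK.
have lbd u : (wnorm b u < +oo)%E -> ((normc (l u))%:E <= c%:E * wnorm b u)%E.
  move=> uy; rewrite /l normc_conj.
  rewrite (wnorm_finE uy) -EFinM lee_fin.
  by apply: fbd; apply/(H1P _ mb).
have [il lx] := reproducing_formula H_hilbert s_dense measurable_weight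
  weight_ge1 ma mb aeC bxy (ba (b x)) lE (cmeasurable_conj mfa) lbd.
rewrite -[LHS]conjCK -/(l (b x)) lx -cintegral_conj//.
rewrite /kernel_op; congr cintegral; apply/funext => y.
by rewrite rmorphM /= /l conjCK -dotC mulrC.
Qed.

(** Where [b x] lies in E the reproducing formula applies; elsewhere f (b x) = 0 by the extension
    convention. So f o b equals an indicator times a kernel operator applied to f o a, which gives
    at once its measurability and the domination that solidity asks for. *)
Lemma coorbit_transfer a b : wm a -> wm b ->
  dual_pair mu dot b a -> Am mu m (gramian dot b a) ->
  Am mu m (gramian dot b b) ->
  exists2 C : R, 0 <= C & forall f,
    antidual (H1 mu dot b v) (H1_norm mu dot b v) f -> Y (fun x => f (a x)) ->
    Y (fun x => f (b x)) /\ nY (fun x => f (b x)) <= C * nY (fun x => f (a x)).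
Proof.
move=> ma mb ba Aba Abb.
have [C C0 KC] := kernel_op_bounded Abb; exists C => // f fE Yfa.
have [mfa _] := fs_L1loc Y1 Yfa.
have [YK nYK] := KC _ Yfa.
set F := kernel_op mu _ _ in YK nYK.
pose A : set (borel X) := [set x | (wnorm b (b x) < +oo)%E].
have mA : measurable A.
  rewrite -[A]setTI; apply: emeasurable_fun_infty_o => //.
  exact: (measurable_wnorm mu H_hilbert s_dense measurable_weight weight_ge1 mb mb).
have fbE : (fun x : borel X => f (b x)) = (fun x => (\1_A x)%:C%C * F x).
  apply/funext => x; rewrite indicE; have [Ax|nAx] := boolP (x \in A).
    rewrite mul1r; apply: antidual_reproducing => //.
    by move: Ax; rewrite inE.
  rewrite mul0r; case: fE => _ _; apply => /(H1P _ mb) bx.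
  by move: nAx; rewrite notin_setE.
have [mF locF] := fs_L1loc Y1 YK.
have mfb : cmeasurable (fun x : borel X => f (b x)).
  by rewrite fbE; apply: cmeasurableM => //; exact: cmeasurable_indic.
have fb_le x : normc (f (b x)) <= normc (F x).
  rewrite (congr1 (fun G => G x) fbE) Normc.normcM normcR -[leRHS]mul1r.
  rewrite ler_wpM2r ?normc_ge0// indicE; case: (_ \in _); rewrite ?normr1 ?normr0//.
have Lfb : L1loc mu (fun x => f (b x)).
  split=> // Q cQ; apply: le_lt_trans (locF Q cQ).
  apply: ge0_le_integral.
  - exact: borel_compact.
  - by move=> x _; rewrite lee_fin normc_ge0.
  - by apply: measurable_funS (measurable_normcE mfb).
  - by apply: measurable_funS (measurable_normcE mF).
  - by move=> x _; rewrite lee_fin.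
have [|Yfb nYfb] := fs_solid Y1 Lfb YK; first exact: aeW.
by split=> //; exact: le_trans nYK.
Qed.

End coorbit_spaces.

(** * Completions *)

Section completions.
Context (R : realType).

Lemma lipschitz_continuous_hnorm (B1 B2 : completeNormedModType R[i])
    (f : B1 -> B2) (k : R) :
  (forall x y, hnorm (f x - f y) <= k * hnorm (x - y)) -> continuous f.
Proof.
move=> fk x; apply/cvgrPdist_lt => eps eps0.
have epsE : eps = (Re eps)%:C%C by rewrite RRe_real// gtr0_real.
have e0 : 0 < Re eps by rewrite -ltcR -epsE.
have k1 : 0 < `|k| + 1 by rewrite ltr_wpDl.
have d0 : 0 < ((Re eps / (`|k| + 1))%:C%C : R[i]) by rewrite ltcR divr_gt0.
have /cvgrPdist_lt/(_ _ d0) : y @[y --> x] --> x by exact: cvg_id.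
apply: filterS => y; rewrite hnormE ltcR epsE hnormE ltcR => xy.
apply: le_lt_trans (fk _ _) _.
apply: (@le_lt_trans _ _ ((`|k| + 1) * hnorm (x - y))).
  by rewrite ler_wpM2r ?hnorm_ge0// (le_trans (ler_norm k))// lerDl.
by rewrite mulrC -ltr_pdivlMr.
Qed.

Section extension.
Context (T : Type) (E : set (T -> R[i])) (n1 n2 : (T -> R[i]) -> R).
Hypothesis E_lin : forall (a : R[i]) f g, E f -> E g -> E (fun t => a * f t + g t).
Variable k : R.
Hypothesis k0 : 0 <= k.
Hypothesis n2_le : forall f, E f -> n2 f <= k * n1 f.
Context (B1 B2 : completeNormedModType R[i]).
Variables (i1 : (T -> R[i]) -> B1) (i2 : (T -> R[i]) -> B2).
Hypotheses (c1 : completion E n1 i1) (c2 : completion E n2 i2).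

Lemma completion_hnorm (n : (T -> R[i]) -> R) (B : completeNormedModType R[i])
    (i : (T -> R[i]) -> B) f : completion E n i -> E f -> hnorm (i f) = n f.
Proof. by move=> [_ iE _] Ef; apply: complexI; rewrite -hnormE iE. Qed.

Lemma completion_dense b (e : R) : 0 < e -> exists2 f, E f & hnorm (b - i1 f) < e.
Proof.
case: c1 => _ _ d1 e0.
have [||x [/= bx [f Ef fx]]] := d1 (ball b (e%:C)%C).
- by exists b; apply: ballxx; rewrite ltcR.
- exact: ball_open.
exists f => //; rewrite -ltcR -hnormE fx.
by move: bx; rewrite -ball_normE.
Qed.

Lemma completion_le f g : E f -> E g ->
  hnorm (i2 f - i2 g) <= k * hnorm (i1 f - i1 g).
Proof.
move=> Ef Eg; have Efg := E_lin (-1) Eg Ef.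
case: (c1) => l1 _ _; case: (c2) => l2 _ _.
have -> : i2 f - i2 g = i2 (fun t => -1 * g t + f t).
  by rewrite l2// scaleN1r addrC.
have -> : i1 f - i1 g = i1 (fun t => -1 * g t + f t).
  by rewrite l1// scaleN1r addrC.
by rewrite (completion_hnorm c1)// (completion_hnorm c2)// n2_le.
Qed.

(** The extension of i1 f |-> i2 f is built as the closure of its graph, not as a limit along chosen
    sequences. The relation is symmetric in the two completions, so the inverse is the transposed
    relation. *)
Definition graph_closure (b : B1) (c : B2) : Prop := forall e : R, 0 < e ->
  exists f, [/\ E f, hnorm (b - i1 f) <= e & hnorm (c - i2 f) <= e].

Lemma graph_closure_image f : E f -> graph_closure (i1 f) (i2 f).
Proof.
move=> Ef e /ltW e0; exists f.
by rewrite !subrr /hnorm !normr0 /=; split.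
Qed.

Lemma graph_closure_lin a b b' c c' : graph_closure b c -> graph_closure b' c' ->
  graph_closure (a *: b + b') (a *: c + c').
Proof.
move=> bc bc' e e0; have a1 : 0 < normc a + 1 by rewrite ltr_wpDl// normc_ge0.
have [f [Ef bf cf]] := bc _ (divr_gt0 e0 a1).
have [f' [Ef' bf' cf']] := bc' _ (divr_gt0 e0 a1).
exists (fun t => a * f t + f' t).
case: (c1) => l1 _ _; case: (c2) => l2 _ _.
have aux (B : completeNormedModType R[i]) (x x' y y' : B) :
    hnorm (x - y) <= e / (normc a + 1) -> hnorm (x' - y') <= e / (normc a + 1) ->
    hnorm (a *: x + x' - (a *: y + y')) <= e.
  move=> xy xy'; rewrite opprD addrACA -scalerBr.
  apply: le_trans (ler_hnormD _ _) _; rewrite hnormZ.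
  apply: le_trans (lerD (ler_wpM2l (normc_ge0 a) xy) xy') _.
  rewrite -{2}(mul1r (e / _)) -mulrDl mulrCA divff ?mulr1//.
  exact: lt0r_neq0.
by split; [exact: E_lin|rewrite l1//; exact: aux|rewrite l2//; exact: aux].
Qed.

Lemma graph_closure_le b c : graph_closure b c -> hnorm c <= k * hnorm b.
Proof.
move=> bc; apply/ler_addgt0Pr => e e0.
(* With tolerance q = e / (k + 1), approximating [c] costs q and approximating [b] costs k q, which
   add up to [e]. *)
have k1 : 0 < k + 1 by rewrite ltr_wpDl.
have [f [Ef bf cf]] := bc _ (divr_gt0 e0 k1).
have le_f : hnorm (i2 f) <= k * hnorm (i1 f).
  by rewrite (completion_hnorm c1)// (completion_hnorm c2)// n2_le.
have cle : hnorm c <= hnorm (c - i2 f) + hnorm (i2 f).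
  by apply: le_trans (ler_hnormD _ _); rewrite subrK.
have ble : hnorm (i1 f) <= hnorm (b - i1 f) + hnorm b.
  by rewrite hnormB; apply: le_trans (ler_hnormD _ _); rewrite subrK.
apply: le_trans cle _; apply: le_trans (lerD cf le_f) _.
apply: le_trans (lerD (lexx _) (ler_wpM2l k0 (le_trans ble (lerD bf (lexx _))))) _.
set q := e / (k + 1); have qe : q * (k + 1) = e.
  by rewrite divfK// lt0r_neq0.
by rewrite (_ : k * hnorm b + e = q + k * (q + hnorm b))// -{1}qe; ring.
Qed.

Lemma graph_closure_uniq b c c' :
  graph_closure b c -> graph_closure b c' -> c = c'.
Proof.
move=> bc bc'; have := graph_closure_le (graph_closure_lin (-1) bc' bc).
rewrite !scaleN1r addNr {2}/hnorm normr0 mulr0 => le0.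
apply/eqP; rewrite -subr_eq0 -normr_eq0 hnormE addrC.
have -> // : hnorm (- c' + c) = 0 by apply/eqP; rewrite eq_le le0 hnorm_ge0.
Qed.

(** If i1 (f n) tends to [b], the bound of [n2] by [n1] makes i2 (f n) a Cauchy sequence, and
    completeness of [B2] provides [c]. *)
Lemma graph_closure_total b : exists c, graph_closure b c.
Proof.
have inv0 n : 0 < n.+1%:R^-1 :> R by rewrite invr_gt0.
have /choice[f fE] : forall n, exists f, E f /\ hnorm (b - i1 f) <= n.+1%:R^-1.
  by move=> n; have [f Ef /ltW bf] := completion_dense b (inv0 n); exists f.
have f_le p q : (p <= q)%N ->
    hnorm (i2 (f p) - i2 (f q)) <= k * (2 * p.+1%:R^-1).
  move=> pq; have [Ep bp] := fE p; have [Eq bq] := fE q.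
  apply: le_trans (completion_le Ep Eq) _; rewrite ler_wpM2l//.
  have -> : i1 (f p) - i1 (f q) = (i1 (f p) - b) + (b - i1 (f q)).
    by rewrite addrA subrK.
  apply: le_trans (ler_hnormD _ _) _; rewrite (hnormB (i1 _)).
  rewrite mulr2n mulrDl mul1r; apply: lerD => //; apply: le_trans bq _.
  by rewrite lef_pV2 ?posrE// ler_nat.
have small (e : R) : 0 < e -> exists n : nat,
    k * (2 * n.+1%:R^-1) < e /\ n.+1%:R^-1 <= e.
  move=> e0; have k1 : 0 < 2 * k + 1 by rewrite ltr_wpDl// mulr_ge0.
  have := divr_gt0 e0 k1 => /ltr_add_invr[n]; rewrite add0r => ne; exists n.
  move: ne; rewrite ltr_pdivlMr//; set u := n.+1%:R^-1 => ne.
  have u0 : 0 < u by exact: inv0.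
  have ku : 0 <= k * u by rewrite mulr_ge0// ltW.
  have ue : u * (2 * k + 1) = 2 * (k * u) + u by ring.
  by rewrite mulrCA; move: ne; rewrite ue; move: (k * u) ku => w *; split; lra.
have : cvg (i2 (f n) @[n --> \oo]).
  apply: cauchy_cvg; apply: cauchy_exP => eps eps0.
  have epsE : eps = (Re eps)%:C%C by rewrite RRe_real// gtr0_real.
  have e0 : 0 < Re eps by rewrite -ltcR -epsE.
  have [n [ne _]] := small _ e0; exists (i2 (f n)).
  exists n => // p /= np; rewrite -ball_normE /= hnormE epsE ltcR.
  exact: le_lt_trans (f_le _ _ np) ne.
move=> /cvg_ex[c fc]; exists c => e e0.
have e0' : 0 < (e%:C%C : R[i]) by rewrite ltcR.
have [N _ fN] : \forall n \near \oo, `|c - i2 (f n)| < e%:C%C.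
  by move/cvgrPdist_lt : fc; exact.
have [n [_ ne]] := small _ e0.
have [En bn] := fE (maxn N n).
exists (f (maxn N n)); split=> //.
  apply: le_trans bn (le_trans _ ne).
  by rewrite lef_pV2 ?posrE// ler_nat ltnS leq_maxr.
by have := fN _ (leq_maxl N n); rewrite /= hnormE ltcR => /ltW.
Qed.

End extension.

(** Both graph closures are single-valued and each is the transpose of the other, so the two chosen
    maps are mutually inverse; linearity and the Lipschitz bounds are likewise read off the
    relations. *)
Lemma same_completions_bounded (T : Type) (E : set (T -> R[i]))
    (n1 n2 : (T -> R[i]) -> R) (k1 k2 : R) :
  (forall (a : R[i]) f g, E f -> E g -> E (fun t => a * f t + g t)) ->
  0 <= k1 -> 0 <= k2 -> (forall f, E f -> n2 f <= k2 * n1 f) ->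
  (forall f, E f -> n1 f <= k1 * n2 f) -> same_completions E n1 n2.
Proof.
move=> Elin k10 k20 n2_le n1_le B1 B2 i1 i2 c1 c2.
pose G := graph_closure E i1 i2; pose G' := graph_closure E i2 i1.
have GG' b c : G b c -> G' c b.
  by move=> bc e e0; have [f [Ef ? ?]] := bc e e0; exists f; split.
have G'G c b : G' c b -> G b c.
  by move=> bc e e0; have [f [Ef ? ?]] := bc e e0; exists f; split.
have [J GJ] := choice (graph_closure_total Elin k20 n2_le c1 c2).
have [J' GJ'] := choice (graph_closure_total Elin k10 n1_le c2 c1).
have uniq := graph_closure_uniq Elin k20 n2_le c1 c2.
have uniq' := graph_closure_uniq Elin k10 n1_le c2 c1.
have linG := graph_closure_lin Elin c1 c2.
have linG' := graph_closure_lin Elin c2 c1.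
have Jlin : linear J by move=> a u w; apply: uniq (GJ _) _; exact: linG.
have J'lin : linear J' by move=> a u w; apply: uniq' (GJ' _) _; exact: linG'.
pose J0 : {linear B1 -> B2} :=
  HB.pack J (GRing.isLinear.Build R[i] B1 B2 *:%R J Jlin).
exists J0, J'; split.
- split=> [b|c] /=; first by apply: uniq' (GJ' _) _; exact/GG'/GJ.
  by apply: uniq (GJ _) _; exact/G'G/GJ'.
- apply: (@lipschitz_continuous_hnorm _ _ _ k2) => x y.
  apply: (graph_closure_le k20 n2_le c1 c2).
  by have := linG (-1) _ _ _ _ (GJ y) (GJ x); rewrite !scaleN1r !(addrC (- _)).
- apply: (@lipschitz_continuous_hnorm _ _ _ k1) => x y.
  apply: (graph_closure_le k10 n1_le c2 c1).
  by have := linG' (-1) _ _ _ _ (GJ' y) (GJ' x); rewrite !scaleN1r !(addrC (- _)).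
- by move=> f Ef /=; apply: uniq (GJ _) _; exact: graph_closure_image.
Qed.

Lemma equivalent_norms_bounded (U : Type) (E : set U) (n1 n2 : U -> R) (k1 k2 : R) :
  0 <= k1 -> 0 <= k2 -> (forall f, E f -> 0 <= n1 f) ->
  (forall f, E f -> 0 <= n2 f) -> (forall f, E f -> n2 f <= k2 * n1 f) ->
  (forall f, E f -> n1 f <= k1 * n2 f) -> equivalent_norms E n1 n2.
Proof.
move=> k10 k20 n10 n20 n2_le n1_le; have k11 : 0 < k1 + 1 by rewrite ltr_wpDl.
(* The given bounds may be 0; adding 1 makes the constants positive and only weakens the estimates,
   the norms being nonnegative. *)
exists (k1 + 1)^-1, (k2 + 1); split=> [||f Ef].
- by rewrite invr_gt0.
- by rewrite ltr_wpDl.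
split.
  rewrite mulrC ler_pdivrMr// mulrC; apply: le_trans (n1_le _ Ef) _.
  by rewrite ler_wpM2r ?n20// lerDl.
by apply: le_trans (n2_le _ Ef) _; rewrite ler_wpM2r ?n10// lerDl.
Qed.

End completions.

(** * Antiduals under comparison of norms *)

Section antidual.
Context (R : realType) (H : completeNormedModType R[i]).

Lemma antidual_sub (E : set H) (n1 n2 : H -> R) (k : R) :
  (forall u, E u -> 0 <= n1 u) -> (forall u, E u -> n1 u <= k * n2 u) ->
  antidual E n1 `<=` antidual E n2.
Proof.
move=> n10 n1_le f [flin [c fc] f0]; split=> //; exists (`|c| * k) => u Eu.
apply: le_trans (fc u Eu) _; rewrite -mulrA.
apply: le_trans (ler_wpM2r (n10 _ Eu) (ler_norm c)) _.
by rewrite ler_wpM2l// n1_le.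
Qed.

Lemma antidual_lin (E : set H) (nE : H -> R) (a : R[i]) f g :
  antidual E nE f -> antidual E nE g -> antidual E nE (fun t => a * f t + g t).
Proof.
move=> [fl [c fc] f0] [gl [c' gc] g0]; split.
- by move=> k u w uE wE; rewrite fl// gl//; ring.
- exists (normc a * c + c') => u uE; apply: le_trans (normc_triangle _ _) _.
  rewrite Normc.normcM mulrDl -mulrA lerD//; last exact: gc.
  by rewrite ler_wpM2l ?normc_ge0// fc.
- by move=> u uE; rewrite f0// g0// mulr0 addr0.
Qed.

End antidual.

(** * The canonical dual frame *)

Section canonical_dual.
Context (R : realType) (X : ptopologicalType).
Variable mu : {measure set (borel X) -> \bar R}.
Context (H : completeNormedModType R[i]).
Variable dot : {dot H for Num.conj}.
Variable psi : X -> H.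
Hypothesis psi_frame : continuous_frame mu dot psi.
Hypothesis mpsi : weakly_measurable (T := borel X) dot psi.
Variables S Sinv : H -> H.
Hypothesis S_frame_op : frame_operator mu dot psi S.
Hypothesis SinvK : cancel Sinv S.

(** The product is dominated by |<f, psi_x>|^2 + |<g, psi_x>|^2, integrable by the upper frame
    bound. *)
Lemma frame_cintegrable f g :
  cintegrable mu (fun x : borel X => dot f (psi x) * dot (psi x) g).
Proof.
have [C1 [C2 [_ _ bd]]] := psi_frame.
have mD u : measurable_fun [set: borel X]
    (fun x : borel X => (normc (dot u (psi x)) ^+ 2)%:E).
  by apply/measurable_EFinP; apply: measurable_funX; exact/measurable_normc/mpsi.
apply: cintegrableP.
  by apply: cmeasurableM; [exact: mpsi|exact: weakly_measurableC].
apply: (@le_lt_trans _ _ (\int[mu]_x ((normc (dot f (psi x)) ^+ 2)%:E +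
    (normc (dot g (psi x)) ^+ 2)%:E))%E).
  apply: ge0_le_integral => //.
  - by move=> x _; rewrite lee_fin normc_ge0.
  - apply: measurable_normcE.
    by apply: cmeasurableM; [exact: mpsi|exact: weakly_measurableC].
  - by apply: emeasurable_funD.
  - move=> x _; rewrite -EFinD lee_fin Normc.normcM (dotC _ (psi x)) normc_conj.
    by move: (normc _) (normc _) => p q; have := sqr_ge0 (p - q);
      have := sqr_ge0 p; have := sqr_ge0 q; nra.
rewrite ge0_integralD//; try by move=> x _; rewrite lee_fin sqr_ge0.
by apply: lte_add_pinfty; [case: (bd f)|case: (bd g)] => _ /le_lt_trans; apply;
  rewrite ltry.
Qed.

Lemma frame_operator_sym f g : dot (S f) g = dot f (S g).
Proof.
rewrite S_frame_op dotC S_frame_op -cintegral_conj; last exact: frame_cintegrable.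
congr cintegral; apply/funext => x.
by rewrite rmorphM /= -!dotC mulrC.
Qed.

(** [Sinv] is given as a bare map, and its symmetry is inherited from [S]. Rewriting <f, Sinv psi_x>
    as <Sinv f, psi_x> reduces questions about the dual family to [psi]. *)
Lemma frame_inverse_sym f g : dot (Sinv f) g = dot f (Sinv g).
Proof. by rewrite -{1}(SinvK g) -frame_operator_sym SinvK. Qed.

Lemma weakly_measurable_dual : weakly_measurable (T := borel X) dot (Sinv \o psi).
Proof. by move=> f; under eq_fun do rewrite /= -frame_inverse_sym; exact: mpsi. Qed.

Lemma canonical_dual_pair g u :
  cintegrable mu (fun y : borel X => dot g (Sinv (psi y)) * dot (psi y) u) /\
  dot g u = cintegral mu (fun y : borel X => dot g (Sinv (psi y)) * dot (psi y) u).
Proof.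
have -> : (fun y : borel X => dot g (Sinv (psi y)) * dot (psi y) u) =
    (fun y => dot (Sinv g) (psi y) * dot (psi y) u).
  by apply/funext => y; rewrite frame_inverse_sym.
by rewrite -S_frame_op SinvK; split; [exact: frame_cintegrable|].
Qed.

End canonical_dual.

(** * Equality of the two coorbit spaces *)

Theorem proposition4p2 (R : realType)
  (H : completeNormedModType R[i]) (dot : {dot H for Num.conj})
  (H_hilbert : hilbert dot) (H_separable : separable H)
  (X : ptopologicalType) (X_hausdorff : hausdorff_space X)
  (X_loccompact : locally_compact [set: X]) (X_sigma_compact : sigma_compact X)
  (mu : {measure set (borel X) -> \bar R})
  (mu_radon : radon_measure mu) (mu_support : msupport mu = [set: X])
  (psi : X -> H) (psi_frame : continuous_frame mu dot psi)
  (psi_continuous : weakly_continuous dot psi) (psi_bounded : bounded_family psi)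
  (S Sinv : H -> H) (S_frame_op : frame_operator mu dot psi S)
  (SK : cancel S Sinv) (SinvK : cancel Sinv S)
  (m : X -> X -> R) (m_admissible : admissible m)
  (Y : set (X -> R[i])) (nY : (X -> R[i]) -> R)
  (Y1 : solid_banach_space mu Y nY) (Y2 : Am_acts mu m Y nY)
  (R_localized : Am mu m (gramian dot (Sinv \o psi) psi))
  (z : X) :
  let psit := Sinv \o psi in
  let v := fun x => m x z in
  intrinsically_localized mu dot m psi ->
  intrinsically_localized mu dot m psit ->
  [/\ Co mu dot psi psit v Y = tCo mu dot psi psit v Y,
      equivalent_norms (Co mu dot psi psit v Y)
        (coorbit_norm psi nY) (coorbit_norm psit nY),
      same_completions (Co mu dot psi psit v Y)
        (coorbit_norm psi nY) (coorbit_norm psit nY),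
      H1 mu dot psi v = H1 mu dot psit v &
      equivalent_norms (H1 mu dot psi v)
        (H1_norm mu dot psi v) (H1_norm mu dot psit v)].
Proof.
move=> psit v loc loct.
have [nu nuE] := sigma_finite_measure_ex
  (radon_sigma_finite X_hausdorff X_sigma_compact mu_radon).
subst mu.
have [s s_dense] := separable_hnorm H_separable.
have mpsi : weakly_measurable (T := borel X) dot psi.
  by move=> f; apply: borel_ccontinuous; exact: psi_continuous.
have mpsit : weakly_measurable (T := borel X) dot psit.
  exact: (weakly_measurable_dual psi_frame).
have pair : dual_pair (T := borel X) nu dot psit psi.
  by move=> g u; exact: (canonical_dual_pair psi_frame).
have pair' := dual_pairC pair.
(* By the symmetry of [Sinv] the cross Gramian is the same in both orders, so the single hypothesis
   [R_localized] serves both directions of the transfer. *)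
have gramE : gramian dot psi psit = gramian dot psit psi.
  apply/funext => x; apply/funext => y.
  exact: (frame_inverse_sym psi_frame mpsi S_frame_op).
have R_localized' : Am nu m (gramian dot psi psit).
  by rewrite gramE; exact: R_localized.
have [c1 c10 le1] := H1_sub H_hilbert s_dense m_admissible z mpsi mpsit pair loc.
have [c2 c20 le2] := H1_sub H_hilbert s_dense m_admissible z mpsit mpsi pair' loct.
have E1 f := H1P nu m z f mpsi; have E2 f := H1P nu m z f mpsit.
have HE : H1 nu dot psi v = H1 nu dot psit v.
  apply/seteqP; split=> f.
    by move=> /E1 fE; apply/E2; have [] := le2 f fE.
  by move=> /E2 fE; apply/E1; have [] := le1 f fE.
have n0 a f : 0 <= H1_norm nu dot a v f.
  by apply/fine_ge0/wnorm_ge0; exact: weight_ge0.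
have n1_le f : H1 nu dot psi v f -> H1_norm nu dot psi v f <= c1 * H1_norm nu dot psit v f.
  by rewrite HE => /E2/le1[].
have n2_le f : H1 nu dot psi v f -> H1_norm nu dot psit v f <= c2 * H1_norm nu dot psi v f.
  by move=> /E1/le2[].
(* The underlying subspaces are already equal, so the extensions by zero agree and only the
   boundedness conditions remain to be compared. *)
have antiE : antidual (H1 nu dot psit v) (H1_norm nu dot psit v) =
             antidual (H1 nu dot psi v) (H1_norm nu dot psi v).
  rewrite -HE; apply/seteqP; split.
    by apply: antidual_sub n2_le => u _; exact: n0.
  by apply: antidual_sub n1_le => u _; exact: n0.
have [k2 k20 tr2] := coorbit_transfer X_hausdorff H_hilbert s_dense m_admissible z Y1 Y2
  mpsi mpsit pair R_localized loct.
have [k1 k10 tr1] := coorbit_transfer X_hausdorff H_hilbert s_dense m_admissible z Y1 Y2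
  mpsit mpsi pair' R_localized' loc.
have CoE : Co nu dot psi psit v Y = tCo nu dot psi psit v Y.
  apply/seteqP; split=> f [fE Yf]; split.
  - by rewrite -antiE.
  - by have [] := tr2 f fE Yf.
  - by rewrite antiE.
  - by have [] := tr1 f fE Yf.
have Co_lin a f g : Co nu dot psi psit v Y f -> Co nu dot psi psit v Y g ->
    Co nu dot psi psit v Y (fun t => a * f t + g t).
  move=> [fE Yf] [gE Yg]; split; first exact: antidual_lin.
  exact: (fs_linear Y1 a Yf Yg).
have m2_le f : Co nu dot psi psit v Y f -> coorbit_norm psit nY f <= k2 * coorbit_norm psi nY f.
  by move=> [fE Yf]; have [] := tr2 f fE Yf.
have m1_le f : Co nu dot psi psit v Y f -> coorbit_norm psi nY f <= k1 * coorbit_norm psit nY f.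
  by rewrite CoE => -[fE Yf]; have [] := tr1 f fE Yf.
split=> //.
- apply: (equivalent_norms_bounded k10 k20) => // f.
    by move=> [_ Yf]; exact: (nY_ge0 Y1).
  by rewrite CoE => -[_ Yf]; exact: (nY_ge0 Y1).
- exact: (same_completions_bounded Co_lin k10 k20).
- by apply: (equivalent_norms_bounded c10 c20).
Qed.
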